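(* The flying block puzzle (with no bound on the number of times each piece may be moved) can be solved in polynomial time on instances in which the frame is a rectangle of width $1$.
   Context: A polyomino is a polygon formed by joining one or more unit squares edge to edge. A feasible packing of a set of polyominoes (pieces) into a polyomino $F$ (the frame) is an arrangement of all pieces inside $F$ with no two overlapping (except along edges and vertices), all piece vertices on grid points of $F$, and all piece edges parallel or perpendicular to the edges of $F$. A fly of a piece consists of picking it up, translating and/or rotating it (but not turning it over) as desired, and putting it back so that the result is a feasible packing. The flying block puzzle: given a set of pieces, a frame $F$, an initial feasible packing, a specified piece $P$, and a goal position of $P$ in $F$, decide whether there is a finite sequence of flies, starting from the initial packing, that brings $P$ to the goal position. *)

(* Defs.v *)
From mathcomp Require Import all_boot all_order all_algebra.
Set Implicit Arguments.
Unset Strict Implicit.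
Unset Printing Implicit Defensive.
Import GRing.Theory Num.Theory.

Definition cell := (int * int)%type.

(* rotation by a quarter turn (no reflections: pieces are not turned over) *)
Definition rot90 (p : cell) : cell := ((- p.2)%R, p.1).

Definition transform (r : nat) (a b : int) (p : cell) : cell :=
  let q := iter r rot90 p in ((q.1 + a)%R, (q.2 + b)%R).

Definition placement_of (S Q : seq cell) : Prop :=
  exists (r : nat) (a b : int), r < 4 /\ Q =i map (transform r a b) S.

Definition adj (p q : cell) : bool :=
  ((p.1 == q.1) && ((p.2 == q.2 + 1)%R || (q.2 == p.2 + 1)%R)) ||
  ((p.2 == q.2) && ((p.1 == q.1 + 1)%R || (q.1 == p.1 + 1)%R)).

Definition polyomino (S : seq cell) : Prop :=
  S != [::] /\ uniq S /\
  forall x y, x \in S -> y \in S ->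
    exists p : seq cell,
      [/\ path adj x p, last x p = y & all (fun z => z \in S) p].

Definition width1_rect (F : seq cell) : Prop :=
  exists (x0 y0 : int) (n : nat), 0 < n /\
    (F =i [seq ((x0 + i%:Z)%R, y0) | i <- iota 0 n] \/
     F =i [seq (x0, (y0 + i%:Z)%R) | i <- iota 0 n]).

Definition feasible (F : seq cell) (shapes conf : seq (seq cell)) : Prop :=
  [/\ size conf = size shapes,
      (forall i, i < size shapes ->
         placement_of (nth [::] shapes i) (nth [::] conf i) /\
         {subset nth [::] conf i <= F}) &
      (forall i j, i < size conf -> j < size conf -> i != j ->
         forall x, x \in nth [::] conf i -> x \notin nth [::] conf j)].

Definition fly (F : seq cell) (shapes c c' : seq (seq cell)) : Prop :=
  exists i, [/\ i < size c, size c' = size c,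
    (forall j, j != i -> nth [::] c' j = nth [::] c j),
    placement_of (nth [::] c i) (nth [::] c' i) &
    feasible F shapes c'].

Inductive reach (F : seq cell) (shapes : seq (seq cell))
  : seq (seq cell) -> seq (seq cell) -> Prop :=
| reach_refl c : reach F shapes c c
| reach_step c c' c'' : reach F shapes c c' -> fly F shapes c' c'' ->
    reach F shapes c c''.

(* An instance of the flying block puzzle. The initial packing gives the
   pieces themselves (piece i is the cell set pieces`_i). *)
Record instance := Instance {
  frame : seq cell;
  pieces : seq (seq cell);
  target : nat;
  goal : seq cell
}.

Definition valid_width1 (I : instance) : Prop :=
  [/\ width1_rect (frame I), uniq (frame I),
      (forall i, i < size (pieces I) -> polyomino (nth [::] (pieces I) i)),
      feasible (frame I) (pieces I) (pieces I) &
      [/\ target I < size (pieces I), uniq (goal I),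
          placement_of (nth [::] (pieces I) (target I)) (goal I) &
          {subset goal I <= frame I}]].

Definition solvable (I : instance) : Prop :=
  exists c, reach (frame I) (pieces I) (pieces I) c /\
            nth [::] c (target I) =i goal I.

Fixpoint nbits_aux (f n : nat) : seq bool :=
  if f is f'.+1 then (if n is 0 then [::] else odd n :: nbits_aux f' n./2)
  else [::].

Definition enc_nat (n : nat) : seq bool :=
  flatten [seq [:: true; b] | b <- nbits_aux n n] ++ [:: false; false].

Definition enc_int (z : int) : seq bool :=
  match z with Posz n => false :: enc_nat n | Negz n => true :: enc_nat n end.

Definition enc_cell (p : cell) : seq bool := enc_int p.1 ++ enc_int p.2.

Definition enc_seq (A : Type) (e : A -> seq bool) (s : seq A) : seq bool :=
  flatten [seq true :: e x | x <- s] ++ [:: false].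

Definition encode (I : instance) : seq bool :=
  enc_seq enc_cell (frame I) ++ enc_seq (enc_seq enc_cell) (pieces I) ++
  enc_nat (target I) ++ enc_seq enc_cell (goal I).

(* states 'I_k.+1 (start = 0); tape alphabet 'I_s.+3 with 0 = blank,    *)
(* 1 = input bit false, 2 = input bit true; the machine halts when the  *)
(* transition is undefined; direction true = right, false = left.       *)

Record TM := MkTM {
  tm_k : nat;
  tm_s : nat;
  tm_delta : 'I_tm_k.+1 -> 'I_tm_s.+3 -> option ('I_tm_k.+1 * 'I_tm_s.+3 * bool);
  tm_accept : 'I_tm_k.+1 -> bool
}.

Definition tm_config (M : TM) : Type :=
  ('I_(tm_k M).+1 * int * (int -> 'I_(tm_s M).+3))%type.

Definition tm_blank (M : TM) : 'I_(tm_s M).+3 := ord0.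
Definition tm_bit (M : TM) (b : bool) : 'I_(tm_s M).+3 :=
  if b then inord 2 else inord 1.

Definition tm_init (M : TM) (w : seq bool) : tm_config M :=
  (ord0, 0%R,
   fun z : int => if ((0 <= z)%R && (`|z|%N < size w)) then tm_bit M (nth false w `|z|%N)
                  else tm_blank M).

Definition tm_step (M : TM) (c : tm_config M) : tm_config M :=
  let: (q, h, t) := c in
  match tm_delta q (t h) with
  | None => c
  | Some (q', a, d) =>
      (q', (if d then h + 1 else h - 1)%R, fun z => if z == h then a else t z)
  end.

Definition tm_halted (M : TM) (c : tm_config M) : bool :=
  let: (q, h, t) := c in if tm_delta q (t h) is None then true else false.

Definition tm_accepts (M : TM) (c : tm_config M) : bool :=
  let: (q, _, _) := c in tm_accept q.

Definition tm_run (M : TM) (n : nat) (w : seq bool) : tm_config M :=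
  iter n (@tm_step M) (tm_init M w).

(* Main.v *)
(* A frame of width 1 is a row of n cells in which piece i occupies l_i
   consecutive cells. Let e = n - sum l_i, and call a piece big if l_i > e.
   Lifting a big piece leaves only one gap that can hold it, so big pieces keep
   their relative order. Conversely, sliding gathers the e free cells at any
   place, so a small piece can be inserted anywhere in the order; hence two
   packings with the same order of big pieces are reachable from each other.
   It remains to decide whether some packing with the given order of big pieces
   has the target at offset g. The total length to the left of the target must
   lie in [g - e, g], and a small piece is too short to jump over this interval,
   so the small pieces can be distributed greedily: the goal is attainable iff
   the big pieces can be cut (at the target, if it is big) into an initial part
   that fits to the left of offset g and a final part that fits to the right of
   the target.

   This criterion is evaluated by an expression whose loops all run as many times
   as the input is long. Its variables are kept as marks on the tape of a Turing
   machine, and the loop bounds make the running time polynomial. *)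
Require Import Defs.
From mathcomp Require Import all_boot all_order all_algebra.
From mathcomp Require Import zify.
Set Implicit Arguments.
Unset Strict Implicit.
Unset Printing Implicit Defensive.
Import Order.TTheory GRing.Theory Num.Theory.

(** * Register programs on Turing machines *)

(** Coordinates are written in binary and may exceed every polynomial in the length of the word, so
    no register can hold one: its mark would lie too far away. They are compared bit by bit where
    they stand. Registers hold only reading positions, counts and lengths, which stay small because
    the frame is listed cell by cell. In particular a piece is located by counting the frame cells
    before it, which makes the listing order and the orientation of the frame irrelevant. The order
    of the big pieces is never computed either: a cut is a number that is compared with their
    initial offsets.

    Expressions stand between the procedure and the machine so that no running time has to be
    analysed by hand: their cost depends only on the length of the word and is polynomial by
    structural induction. The price is that a shorter iteration must idle until its loop ends, and
    that addition, being iterated successor, needs a summand bounded by the length of the word. *)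

Inductive test := TLt of nat & nat | TBit of nat | TIn of nat.

Inductive cmd :=
| Copy of nat & nat
| Inc of nat
| Seq of cmd & cmd
| Cond of test & cmd & cmd
| While of test & cmd.

Definition upd T (R : nat -> T) i v := fun k => if k == i then v else R k.

Definition test_sem (w : seq bool) (R : nat -> nat) (t : test) : bool :=
  match t with
  | TLt i j => R i < R j
  | TBit i => nth false w (R i)
  | TIn i => R i < size w
  end.

(** The side conditions come from the marks: register 0 must keep the origin, and [Copy i j] erases
    mark [i] before it looks for mark [j]. The last index is the cost; a relation is used because
    [While] may diverge. *)
Inductive exec (w : seq bool) :
  cmd -> (nat -> nat) -> (nat -> nat) -> nat -> Prop :=
| ExecCopy R i j : i != 0 -> i != j -> exec w (Copy i j) R (upd R i (R j)) 1
| ExecInc R i : i != 0 -> exec w (Inc i) R (upd R i (R i).+1) 1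
| ExecSeq c1 c2 R1 R2 R3 s1 s2 : exec w c1 R1 R2 s1 -> exec w c2 R2 R3 s2 ->
    exec w (Seq c1 c2) R1 R3 (s1 + s2)
| ExecThen t c1 c2 R R' s : test_sem w R t -> exec w c1 R R' s ->
    exec w (Cond t c1 c2) R R' s.+1
| ExecElse t c1 c2 R R' s : ~~ test_sem w R t -> exec w c2 R R' s ->
    exec w (Cond t c1 c2) R R' s.+1
| ExecDone t c R : ~~ test_sem w R t -> exec w (While t c) R R 1
| ExecLoop t c R1 R2 R3 s1 s2 : test_sem w R1 t -> exec w c R1 R2 s1 ->
    exec w (While t c) R2 R3 s2 -> exec w (While t c) R1 R3 (s1 + s2).+1.

(** A unit of cost raises the largest register by at most one. Thus the cost also bounds the stretch
    of tape in use, and with it the machine steps per command. *)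
Lemma exec_growth w c R R' s X : exec w c R R' s ->
  (forall k, R k <= X) -> forall k, R' k <= X + s.
Proof.
move=> E; elim: E X => {c R R' s}
  [R i j _ _|R i _|c1 c2 R1 R2 R3 s1 s2 _ IH1 _ IH2|t c1 c2 R R' s _ _ IH
  |t c1 c2 R R' s _ _ IH|t c R _|t c R1 R2 R3 s1 s2 _ _ IH1 _ IH2] X bX k.
- by rewrite /upd; case: eqP => _; apply: leq_trans (bX _) _; rewrite leq_addr.
- rewrite /upd; case: eqP => _; first by rewrite addn1 ltnS.
  by apply: leq_trans (bX _) _; rewrite leq_addr.
- by rewrite addnA; apply: IH2; apply: IH1.
- by rewrite addnS leqW // IH.
- by rewrite addnS leqW // IH.
- by apply: leq_trans (bX _) _; rewrite leq_addr.
- by rewrite addnS leqW // addnA; apply: IH2; apply: IH1.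
Qed.

(** No command assigns register 0, which can therefore serve both as the origin and as the constant
    zero. *)
Lemma exec_zero w c R R' s : exec w c R R' s -> R 0 = 0 -> R' 0 = 0.
Proof.
elim=> {c R R' s} //; last by move=> *; eauto.
- by move=> R i j i0 _; rewrite /upd eq_sym (negbTE i0).
- by move=> R i i0; rewrite /upd eq_sym (negbTE i0).
- by move=> *; eauto.
Qed.

Section Machine.

(* Register i is the cell carrying mark i, and register 0 marks the origin.
   A machine must move at each step, so the head rests at cell 1 between
   commands. [inord] makes indices above [m] meaningless; [reg_bound] excludes
   them. *)
Variable m : nat.

(** The input letter stays readable under the marks, so tests on the input need no copy of it. *)
Definition sym := (option bool * {set 'I_m.+1})%type.
Definition instr := (sym -> sym * bool * nat)%type.
Implicit Types (a : sym) (R : nat -> option nat) (p q pc : nat).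

Definition marked i a := inord i \in a.2.
Definition mark i a : sym := (a.1, inord i |: a.2).
Definition unmark i a : sym := (a.1, a.2 :\ inord i).

Definition go_left k : instr := fun a => (a, false, k).
Definition scan (f : pred sym) (act : sym -> sym) (next : sym -> nat) k : instr :=
  fun a => if f a then (act a, true, next a) else (a, true, k).
Definition return_from k k' : instr :=
  fun a => if marked 0 a then (a, true, k') else (a, false, k).

Definition test_stop t : pred sym := fun a =>
  match t with
  | TLt i j => marked i a || marked j a
  | TBit i | TIn i => marked i a
  end.
(** For [TLt i j] the scan stops at the first of the two marks; then [R i < R j] exactly when mark
    [j] is absent from that cell. *)
Definition test_val t : pred sym := fun a =>
  match t with
  | TLt i j => ~~ marked j a
  | TBit i => a.1 == Some true
  | TIn i => a.1 != None
  end.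

Definition gen_test t s kt kf : seq instr :=
  [:: go_left s.+1;
      scan (test_stop t) id (fun a => if test_val t a then s.+2 else s.+3) s.+1;
      return_from s.+2 kt; return_from s.+3 kf].

Fixpoint code_size c :=
  match c with
  | Copy _ _ => 6
  | Inc _ => 4
  | Seq c1 c2 => code_size c1 + code_size c2
  | Cond _ c1 c2 => 4 + (code_size c1 + code_size c2)
  | While _ c => 4 + code_size c
  end.

(* Code placed at address [s], leaving through address [k]. *)
Fixpoint gen c s k : seq instr :=
  match c with
  | Copy i j =>
      [:: go_left s.+1; scan (marked i) (unmark i) (fun=> s.+2) s.+1;
          return_from s.+2 s.+3;
          go_left s.+4; scan (marked j) (mark i) (fun=> s.+4.+1) s.+4;
          return_from s.+4.+1 k]
  | Inc i =>
      [:: go_left s.+1; scan (marked i) (unmark i) (fun=> s.+2) s.+1;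
          scan predT (mark i) (fun=> s.+3) s.+2; return_from s.+3 k]
  | Seq c1 c2 => gen c1 s (s + code_size c1) ++ gen c2 (s + code_size c1) k
  | Cond t c1 c2 =>
      gen_test t s (s + 4) (s + 4 + code_size c1) ++
      gen c1 (s + 4) k ++ gen c2 (s + 4 + code_size c1) k
  | While t c => gen_test t s (s + 4) k ++ gen c (s + 4) s
  end.

Lemma size_gen c s k : size (gen c s k) = code_size c.
Proof.
elim: c s k => //= [c1 IH1 c2 IH2|t c1 IH1 c2 IH2|t c IH] s k.
- by rewrite size_cat IH1 IH2.
- by rewrite size_cat IH1 IH2.
- by rewrite IH.
Qed.

Definition test_bound t :=
  match t with TLt i j => maxn i j | TBit i | TIn i => i end.
Fixpoint reg_bound c :=
  match c with
  | Copy i j => maxn i j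
  | Inc i => i
  | Seq c1 c2 => maxn (reg_bound c1) (reg_bound c2)
  | Cond t c1 c2 => maxn (test_bound t) (maxn (reg_bound c1) (reg_bound c2))
  | While t c => maxn (test_bound t) (reg_bound c)
  end.

Variable P : seq instr.
Notation K := (size P).

(* Letters 0, 1, 2 are unmarked input letters; the remaining letters enumerate
   [sym], so decoding is onto but not injective. *)
Definition decode (x : 'I_#|{: sym}|.+3) : sym :=
  match val x with
  | 0 => (None, set0)
  | 1 => (Some false, set0)
  | 2 => (Some true, set0)
  | k.+3 => nth (None, set0) (enum {: sym}) k
  end.
Definition encode_sym a : 'I_#|{: sym}|.+3 := inord (index a (enum {: sym})).+3.

Lemma encode_symK : cancel encode_sym decode.
Proof.
move=> a; have ia : index a (enum {: sym}) < #|{: sym}|.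
  by rewrite cardT index_mem mem_enum.
by rewrite /decode /encode_sym /= inordK // nth_index // mem_enum.
Qed.

Definition machine : TM :=
  @MkTM K.+1 #|{: sym}|
    (fun s x => if val s < K then
       let: (a, d, r) := nth (go_left 0) P s (decode x) in
       Some (inord r, encode_sym a, d) else None)
    (fun s => val s == K.+1).

Lemma machine_halted (c : tm_config machine) : tm_halted c = (K <= c.1.1).
Proof.
case: c => -[s h] t; rewrite /tm_halted /=; case: (ltnP s K) => // _.
by case: (nth (go_left 0) P s (decode (t h))) => -[a d] r.
Qed.

Lemma machine_accepts (c : tm_config machine) : tm_accepts c = (val c.1.1 == K.+1).
Proof. by case: c => -[s h] t. Qed.

Variable w : seq bool.

(** [R i = None] means that mark [i] is nowhere, as before the start and midway through [Copy] and
    [Inc]. *)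
Definition tape R (z : int) : sym :=
  if z is Posz p then (onth w p, [set i : 'I_m.+1 | R i == Some p])
  else (None, set0).

(** Tapes are compared after decoding, because a bare input letter and its encoding as a symbol are
    different letters with the same meaning. *)
Definition represents (pc p : nat) R (c : tm_config machine) :=
  [/\ val c.1.1 = pc, c.1.2 = Posz p & forall z, decode (c.2 z) = tape R z].

Definition runs n (pc p : nat) R (pc' p' : nat) R' :=
  forall c, represents pc p R c ->
    represents pc' p' R' (iter n (@tm_step machine) c).

Lemma runs_trans n1 n2 pc1 p1 R1 pc2 p2 R2 pc3 p3 R3 :
  runs n1 pc1 p1 R1 pc2 p2 R2 -> runs n2 pc2 p2 R2 pc3 p3 R3 ->
  runs (n1 + n2) pc1 p1 R1 pc3 p3 R3.
Proof. by move=> H1 H2 c /H1 /H2; rewrite addnC iterD. Qed.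

Lemma runs1 pc p R a d r R' : pc < K ->
  nth (go_left 0) P pc (tape R p) = (a, d, r) -> r <= K.+1 ->
  a = tape R' p -> (forall q i, q != p -> (R' i == Some q) = (R i == Some q)) ->
  (d || (0 < p)) ->
  runs 1 pc p R r (if d then p.+1 else p.-1) R'.
Proof.
move=> ltpc fetch ler aE agree dp [[q h] t] [/= qE hE tE].
rewrite /= qE ltpc hE tE fetch; split => /=.
- by rewrite inordK.
- case: d dp {fetch} => /= [_|]; first by rewrite intS GRing.addrC.
  by case: p {agree aE tE hE} => // k _; rewrite intS GRing.addrC GRing.addKr.
- move=> z; case: eqP => [->|/eqP nz]; first by rewrite encode_symK.
  rewrite tE; case: z nz => //= k nz; congr pair.
  by apply/setP => i; rewrite !inE agree.
Qed.

Definition code_at s l := exists l1 l2, P = l1 ++ l ++ l2 /\ size l1 = s.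

Lemma code_at_cat s l l' :
  code_at s (l ++ l') -> code_at s l /\ code_at (s + size l) l'.
Proof.
move=> [l1 [l2 [PE <-]]]; split.
  by exists l1, (l' ++ l2); rewrite PE -catA.
by exists (l1 ++ l), l2; rewrite size_cat PE -!catA.
Qed.

Lemma code_at_nth s l k : code_at s l -> k < size l ->
  s + k < K /\ nth (go_left 0) P (s + k) = nth (go_left 0) l k.
Proof.
move=> [l1 [l2 [-> <-]]] kl; split; first by rewrite !size_cat ltn_add2l ltn_addr.
by rewrite nth_cat ltnNge leq_addr /= addKn nth_cat kl.
Qed.

Lemma in_tape R p i : i <= m -> marked i (tape R p) = (R i == Some p).
Proof. by move=> im; rewrite /marked inE inordK. Qed.

Lemma runs_left pc p R r : pc < K -> nth (go_left 0) P pc = go_left r ->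
  r <= K.+1 -> runs 1 pc p.+1 R r p R.
Proof.
by move=> lt fetch ler; apply: (runs1 (d := false)) => //; rewrite fetch.
Qed.

Lemma runs_skip f act next pc p q R : pc < K ->
  nth (go_left 0) P pc = scan f act next pc ->
  p <= q -> (forall k, p <= k < q -> ~~ f (tape R k)) ->
  runs (q - p) pc p R pc q R.
Proof.
move=> lt fetch; move: {2}(q - p) (erefl (q - p)) => n.
elim: n p => [|n IH] p def_n lepq notf.
  have ->: q = p by apply/eqP; rewrite eqn_leq lepq -subn_eq0 def_n eqxx.
  by rewrite subnn.
have ltpq : p < q by rewrite -subn_gt0 def_n.
have -> : q - p = 1 + (q - p.+1) by rewrite subnS add1n prednK ?subn_gt0.
apply: (@runs_trans _ _ _ _ _ pc p.+1 R); last first.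
  apply: IH => //; first by rewrite subnS def_n.
  by move=> k /andP[pk kq]; apply: notf; rewrite ltnW.
apply: (runs1 (d := true)) => //; last by rewrite ltnW // ltnW.
by rewrite fetch /scan (negbTE (notf p _)) // leqnn ltpq.
Qed.

Lemma runs_return pc p R r : pc < K -> r <= K.+1 ->
  nth (go_left 0) P pc = return_from pc r -> R 0 = Some 0 ->
  runs p.+1 pc p R r 1 R.
Proof.
move=> lt ler fetch R0; elim: p => [|p IH].
  by apply: (runs1 (d := true)) => //; rewrite fetch /return_from in_tape // R0.
rewrite -add1n; apply: (@runs_trans _ _ _ _ _ pc p R) => //.
apply: (runs1 (d := false)) => //; last by rewrite ltnW // ltnW.
by rewrite fetch /return_from in_tape // R0.
Qed.

Lemma tape_mark R i p : i <= m -> mark i (tape R p) = tape (upd R i (Some p)) p.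
Proof.
move=> im; congr pair; apply/setP => j; rewrite !inE /upd.
by rewrite -val_eqE /= inordK //; case: eqP => //= _; rewrite eqxx.
Qed.

Lemma tape_unmark R i p : i <= m -> unmark i (tape R p) = tape (upd R i None) p.
Proof.
move=> im; congr pair; apply/setP => j; rewrite !inE /upd.
by rewrite -val_eqE /= inordK //; case: eqP.
Qed.

(* The frame shared by all commands: step to the origin, scan to the first cell
   where [f] holds, act there and move right. *)
Lemma runs_scan f act next s q R R' r :
  s < K -> nth (go_left 0) P s = go_left s.+1 ->
  s.+1 < K -> nth (go_left 0) P s.+1 = scan f act next s.+1 ->
  (forall k, k < q -> ~~ f (tape R k)) -> f (tape R q) ->
  next (tape R q) = r -> r <= K.+1 -> act (tape R q) = tape R' q ->
  (forall p i, p != q -> (R' i == Some p) = (R i == Some p)) ->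
  runs (q + 2) s 1 R r q.+1 R'.
Proof.
move=> lts fs lts1 fs1 notf fq nextq ler actq agree.
have -> : q + 2 = 1 + (q - 0 + 1) by lia.
apply: (@runs_trans _ _ _ _ _ s.+1 0 R); first by apply: runs_left => //; lia.
apply: (@runs_trans _ _ _ _ _ s.+1 q R).
  by apply: runs_skip fs1 _ _ => // k /notf.
apply: (runs1 (d := true)) (agree) _ => //.
by rewrite fs1 /scan fq actq nextq.
Qed.

Definition located (R : nat -> nat) i := Some (R i).

Lemma code_at_size s l : code_at s l -> s + size l <= K.
Proof. by move=> [l1 [l2 [-> <-]]]; rewrite !size_cat leq_add2l leq_addr. Qed.

Lemma runs_test t s kt kf (R : nat -> nat) X :
  code_at s (gen_test t s kt kf) -> kt <= K.+1 -> kf <= K.+1 ->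
  R 0 = 0 -> test_bound t <= m -> (forall i, R i <= X) ->
  exists2 n, n <= 8 * X.+1 &
    runs n s 1 (located R) (if test_sem w R t then kt else kf) 1 (located R).
Proof.
move=> cs ktK kfK R0 tm bX; have csz := code_at_size cs.
have [lt0] := code_at_nth (k := 0) cs isT; rewrite addn0 /= => f0.
have [lt1] := code_at_nth (k := 1) cs isT; rewrite addn1 /= => f1.
have [lt2] := code_at_nth (k := 2) cs isT; rewrite addn2 /= => f2.
have [lt3] := code_at_nth (k := 3) cs isT; rewrite addn3 /= => f3.
rewrite addn0 in lt0; rewrite addn1 in lt1; rewrite addn2 in lt2; rewrite addn3 in lt3.
pose q := match t with TLt i j => minn (R i) (R j) | TBit i | TIn i => R i end.
have notf k : k < q -> ~~ test_stop t (tape (located R) k).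
  move=> kq; rewrite /test_stop; case: (t) @q kq tm => [i j|i|i] q kq /= tm.
  - rewrite !in_tape /located ?(leq_trans _ tm) ?leq_maxl ?leq_maxr //.
    by apply/negP => /orP[/eqP[]|/eqP[]]; lia.
  - by rewrite in_tape // /located; apply/eqP => -[]; rewrite /q in kq; lia.
  - by rewrite in_tape // /located; apply/eqP => -[]; rewrite /q in kq; lia.
have fq : test_stop t (tape (located R) q).
  rewrite /test_stop /q; case: (t) tm => [i j|i|i] /= tm.
  - rewrite !in_tape /located ?(leq_trans _ tm) ?leq_maxl ?leq_maxr //.
    by case: (leqP (R i) (R j)); rewrite eqxx ?orbT.
  - by rewrite in_tape.
  - by rewrite in_tape.
have vq : test_val t (tape (located R) q) = test_sem w R t.
  rewrite /test_val /q /test_sem; case: (t) tm => [i j|i|i] /= tm.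
  - rewrite in_tape /located ?(leq_trans _ tm) ?leq_maxr // /minn.
    case: ltnP => h; first by apply/eqP => -[]; lia.
    by rewrite eqxx.
  - elim: (w) (R i) => [|b w' IH] [|k] //=; by case: b.
  - by elim: (w) (R i) => [|b w' IH] [|k] //=.
have qX : q <= X.
  by rewrite /q; case: (t) => [i j|i|i] //; rewrite geq_min bX.
(* The scan takes [q + 2] steps to reach cell [q] and pass it; the way back from [q.+1] takes
   [q.+2]. *)
exists (q + 2 + q.+2); first by lia.
apply: (runs_trans (runs_scan (R' := located R) lt0 f0 lt1 f1 notf fq (erefl _) _ _ _)) => //.
  by case: ifP => _; lia.
by rewrite vq; case: test_sem; apply: runs_return => //; rewrite /located R0.
Qed.

Lemma runs_ext n pc p R pc' p' R1 R2 : R1 =1 R2 ->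
  runs n pc p R pc' p' R1 -> runs n pc p R pc' p' R2.
Proof.
move=> eR H c /H [pcE pE tE]; split=> // z; rewrite tE.
by case: z => //= k; congr pair; apply/setP => i; rewrite !inE eR.
Qed.

(** [M] bounds every register during the whole execution, so one factor [n] per unit of cost serves
    all commands and the induction merely adds. The constant 8 comes from [Copy], which makes two
    scans and two returns, at most [4 * M + 8] steps. *)
Lemma runs_gen c (R R' : nat -> nat) s M n :
  exec w c R R' s -> forall st k X, code_at st (gen c st k) -> k <= K.+1 ->
  R 0 = 0 -> reg_bound c <= m -> (forall i, R i <= X) -> X + s <= M ->
  n = 8 * M.+1 ->
  exists2 t, t <= s * n & runs t st 1 (located R) k 1 (located R').
Proof.
move=> E; elim: E => {c R R' s}
  [R i j i0 ij|R i i0|c1 c2 R1 R2 R3 s1 s2 E1 IH1 E2 IH2|t c1 c2 R R' s tt E IH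
  |t c1 c2 R R' s tt E IH|t c R tt|t c R1 R2 R3 s1 s2 tt E1 IH1 E2 IH2]
  st k X cs kK R0 cm bX XM def_n; have := code_at_size cs; rewrite size_gen /= => csz;
  rewrite /= in cs cm.
- have [im jm] : i <= m /\ j <= m by rewrite !geq_max in cm; case/andP: cm.
  have [_] := code_at_nth (k := 0) cs isT; rewrite addn0 /= => f0.
  have [_] := code_at_nth (k := 1) cs isT; rewrite addn1 /= => f1.
  have [_] := code_at_nth (k := 2) cs isT; rewrite addn2 /= => f2.
  have [_] := code_at_nth (k := 3) cs isT; rewrite addn3 /= => f3.
  have [_] := code_at_nth (k := 4) cs isT; rewrite addn4 /= => f4.
  have [_] := code_at_nth (k := 5) cs isT; rewrite addnS addn4 /= => f5.
  pose Ri := upd (located R) i None.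
  have Ri0 : Ri 0 = Some 0 by rewrite /Ri /upd eq_sym (negbTE i0) /located R0.
  exists ((R i + 2 + (R i).+2) + (R j + 2 + (R j).+2)).
    by have := bX i; have := bX j; lia.
  apply: (@runs_trans _ _ _ _ _ st.+3 1 Ri).
    apply: (runs_trans (runs_scan (q := R i) (R' := Ri) _ f0 _ f1 _ _ (erefl _) _ _ _)); try lia.
    - by move=> p pR; rewrite in_tape //; apply/eqP => -[]; lia.
    - by rewrite in_tape.
    - by rewrite tape_unmark.
    - move=> p l pR; rewrite /Ri /upd; case: (eqVneq l i) => [->|//].
      by apply/esym/eqP => -[] E; rewrite E eqxx in pR.
    by apply: runs_return => //; lia.
  apply: (@runs_ext _ _ _ _ _ _ (upd Ri i (Some (R j)))).
    by move=> l; rewrite /Ri /located /upd; case: (l == i).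
  have Rij : Ri j = Some (R j) by rewrite /Ri /upd eq_sym (negbTE ij).
  apply: (runs_trans (runs_scan (q := R j) (R' := upd Ri i (Some (R j))) _ f3 _ f4 _ _ (erefl _) _ _ _)); try lia.
  - by move=> p pR; rewrite in_tape // Rij; apply/eqP => -[]; lia.
  - by rewrite in_tape // Rij.
  - by rewrite tape_mark.
  - move=> p l pR; rewrite /Ri /upd; case: (l == i) => //.
    by apply/eqP => -[] E; rewrite E eqxx in pR.
  by apply: runs_return => //; [lia | rewrite /upd eq_sym (negbTE i0)].
- have [_] := code_at_nth (k := 0) cs isT; rewrite addn0 /= => f0.
  have [_] := code_at_nth (k := 1) cs isT; rewrite addn1 /= => f1.
  have [_] := code_at_nth (k := 2) cs isT; rewrite addn2 /= => f2.
  have [_] := code_at_nth (k := 3) cs isT; rewrite addn3 /= => f3.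
  pose Ri := upd (located R) i None.
  have Ri0 : Ri 0 = Some 0 by rewrite /Ri /upd eq_sym (negbTE i0) /located R0.
  exists ((R i + 2) + (1 + (R i).+3)).
    by have := bX i; lia.
  apply: (@runs_trans _ _ _ _ _ st.+2 (R i).+1 Ri).
    apply: (runs_scan (q := R i) _ f0 _ f1); try lia.
    - by move=> p pR; rewrite in_tape //; apply/eqP => -[]; lia.
    - by rewrite in_tape.
    - by rewrite tape_unmark.
    - move=> p l pR; rewrite /Ri /upd; case: (eqVneq l i) => [->|//].
      by apply/esym/eqP => -[] E; rewrite E eqxx in pR.
  apply: (@runs_ext _ _ _ _ _ _ (upd Ri i (Some (R i).+1))).
    by move=> l; rewrite /Ri /located /upd; case: (l == i).
  apply: (@runs_trans _ _ _ _ _ st.+3 (R i).+2 (upd Ri i (Some (R i).+1))).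
    apply: (runs1 (d := true) (a := tape (upd Ri i (Some (R i).+1)) (R i).+1)); try lia.
    + by rewrite f2 -tape_mark.
    + by [].
    + move=> p l pR; rewrite /Ri /upd; case: (l == i) => //.
      by apply/eqP => -[] E; rewrite E eqxx in pR.
  by apply: runs_return => //; [lia | rewrite /upd eq_sym (negbTE i0)].
- have [cs1] := code_at_cat cs; rewrite size_gen => cs2; rewrite geq_max in cm.
  case/andP: cm => cm1 cm2.
  have [||t1 b1 r1] := IH1 _ _ X cs1 _ R0 cm1 bX _ def_n; try lia.
  have [|t2 b2 r2] := IH2 _ _ (X + s1) cs2 kK (exec_zero E1 R0) cm2 (exec_growth E1 bX) _ def_n; try lia.
  by exists (t1 + t2); [rewrite mulnDl leq_add | apply: runs_trans r1 r2].
- have [cs0 cs1] := code_at_cat (l := gen_test t st (st + 4) (st + 4 + code_size c1)) cs.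
  have [{}cs1 cs2] := code_at_cat cs1.
  rewrite /= size_gen in cs1 cs2; rewrite !geq_max in cm; case/and3P: cm => cm0 cm1 cm2.
  have [||t0 b0] := runs_test cs0 _ _ R0 cm0 bX; try lia.
  rewrite tt => r0.
  have [|t1 b1 r1] := IH _ _ X cs1 kK R0 cm1 bX _ def_n; try lia.
  by exists (t0 + t1); [rewrite mulSn leq_add // def_n; lia | apply: runs_trans r0 r1].
- have [cs0 cs1] := code_at_cat (l := gen_test t st (st + 4) (st + 4 + code_size c1)) cs.
  have [{}cs1 cs2] := code_at_cat cs1.
  rewrite /= size_gen in cs1 cs2; rewrite !geq_max in cm; case/and3P: cm => cm0 cm1 cm2.
  have [||t0 b0] := runs_test cs0 _ _ R0 cm0 bX; try lia.
  rewrite (negbTE tt) => r0.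
  have [|t1 b1 r1] := IH _ _ X cs2 kK R0 cm2 bX _ def_n; try lia.
  by exists (t0 + t1); [rewrite mulSn leq_add // def_n; lia | apply: runs_trans r0 r1].
- have [cs0 cs1] := code_at_cat (l := gen_test t st (st + 4) k) cs.
  rewrite !geq_max in cm; case/andP: cm => cm0 cm1.
  have [||t0 b0] := runs_test cs0 _ _ R0 cm0 bX; try lia.
  rewrite (negbTE tt) => r0; exists t0 => //; rewrite def_n; lia.
- have [cs0 cs1] := code_at_cat (l := gen_test t st (st + 4) k) cs.
  rewrite !geq_max in cm; case/andP: (cm) => cm0 cm1.
  have [||t0 b0] := runs_test cs0 _ _ R0 cm0 bX; try lia.
  rewrite tt => r0.
  have [||t1 b1 r1] := IH1 _ _ X cs1 _ R0 cm1 bX _ def_n; try lia.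
  have [||t2 b2 r2] := IH2 _ _ (X + s1) cs kK (exec_zero E1 R0) _ (exec_growth E1 bX) _ def_n; try lia.
    by rewrite /= geq_max cm0.
  exists (t0 + (t1 + t2)); last exact: runs_trans r0 (runs_trans r1 r2).
  by rewrite mulSn mulnDl !leq_add // def_n; lia.
Qed.

End Machine.

(** * Expressions with bounded loops *)

Inductive exp :=
| Var of nat
| Zero
| Succ of exp
| Lt of exp & exp
| Bit of exp
| If of exp & exp & exp
| Let of exp & exp
| With of seq nat & exp
| Loop of exp & exp.

(* [Loop a b] binds the counter as variable 0 and the accumulator as variable
   1; it always runs [size w] times, so that evaluation is polynomial. *)
Fixpoint eval (w : seq bool) (e : exp) (env : seq nat) : nat :=
  match e with
  | Var i => nth 0 env i
  | Zero => 0
  | Succ a => (eval w a env).+1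
  | Lt a b => eval w a env < eval w b env
  | Bit a => nth false w (eval w a env)
  | If c a b => if 0 < eval w c env then eval w a env else eval w b env
  | Let a b => eval w b (eval w a env :: env)
  | With s a => eval w a [seq nth 0 env i | i <- s]
  | Loop a b => foldl (fun acc i => eval w b (i :: acc :: env))
                      (eval w a env) (iota 0 (size w))
  end.

(* The variables live in the registers [rho], the value is left in register
   [n], and registers below [n] are preserved. *)
Fixpoint compile e (rho : seq nat) n : cmd :=
  match e with
  | Var i => Copy n (nth 0 rho i)
  | Zero => Copy n 0
  | Succ a => Seq (compile a rho n) (Inc n)
  | Lt a b => Seq (compile a rho n) (Seq (compile b rho n.+1)
      (Cond (TLt n n.+1) (Seq (Copy n 0) (Inc n)) (Copy n 0)))
  | Bit a => Seq (compile a rho n)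
      (Cond (TBit n) (Seq (Copy n 0) (Inc n)) (Copy n 0))
  | If c a b => Seq (compile c rho n)
      (Cond (TLt 0 n) (compile a rho n) (compile b rho n))
  | Let a b => Seq (compile a rho n)
      (Seq (compile b (n :: rho) n.+1) (Copy n n.+1))
  | With s a => compile a [seq nth 0 rho i | i <- s] n
  | Loop a b => Seq (compile a rho n) (Seq (Copy n.+1 0)
      (While (TIn n.+1) (Seq (compile b [:: n.+1, n & rho] n.+2)
                             (Seq (Copy n n.+2) (Inc n.+1)))))
  end.

(** Both branches of [If] are charged, so that the bound depends on the length of the word alone. *)
Fixpoint cost e N : nat :=
  match e with
  | Var _ | Zero => 1
  | Succ a => cost a N + 1
  | Lt a b => cost a N + cost b N + 3
  | Bit a => cost a N + 3
  | If c a b => cost c N + (cost a N + cost b N) + 1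
  | Let a b => cost a N + cost b N + 1
  | With _ a => cost a N
  | Loop a b => cost a N + N * (cost b N + 3) + 2
  end.

Lemma exec_bool w n (R : nat -> nat) t : 0 < n ->
  R 0 = 0 ->
  exists R' s, [/\ exec w (Cond t (Seq (Copy n 0) (Inc n)) (Copy n 0)) R R' s,
    s <= 3, R' n = test_sem w R t & forall k, k < n -> R' k = R k].
Proof.
move=> n_gt0 R0; have n0 : n != 0 by rewrite -lt0n.
case tt: (test_sem w R t).
  exists (upd (upd R n (R 0)) n (upd R n (R 0) n).+1), (1 + 1).+1; split=> //.
  - by apply: ExecThen => //; apply: ExecSeq; [apply: ExecCopy | apply: ExecInc].
  - by rewrite /upd eqxx R0.
  - by move=> k kn; rewrite /upd (ltn_eqF kn).
exists (upd R n (R 0)), 1.+1; split=> //.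
- by apply: ExecElse; [rewrite tt | apply: ExecCopy].
- by rewrite /upd eqxx R0.
- by move=> k kn; rewrite /upd (ltn_eqF kn).
Qed.

Lemma nth_all_lt (rho : seq nat) n i : 0 < n ->
  all (fun r => r < n) rho -> nth 0 rho i < n.
Proof.
move=> n0 lt_rho; case: (ltnP i (size rho)) => h; last by rewrite nth_default.
by apply: (allP lt_rho); rewrite mem_nth.
Qed.

Lemma eq_map_lt (rho : seq nat) n (R R' : nat -> nat) : all (fun r => r < n) rho ->
  (forall k, k < n -> R' k = R k) -> map R' rho = map R rho.
Proof. by move=> /allP lt_rho eR; apply/eq_in_map => k /lt_rho /eR. Qed.

Lemma exec_compile w e rho n (R : nat -> nat) :
  0 < n -> all (fun r => r < n) rho -> R 0 = 0 ->
  exists R' s, [/\ exec w (compile e rho n) R R' s, s <= cost e (size w),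
    R' n = eval w e (map R rho) & forall k, k < n -> R' k = R k].
Proof.
elim: e rho n R => [i||a IHa|a IHa b IHb|a IHa|c IHc a IHa b IHb|a IHa b IHb|vs a IHa|a IHa b IHb]
  rho n R n_gt0 lt_rho R0 /=; have n0 : n != 0 by rewrite -lt0n.
- have lti := nth_all_lt i n_gt0 lt_rho.
  exists (upd R n (R (nth 0 rho i))), 1; split=> //.
  + by apply: ExecCopy => //; rewrite eq_sym ltn_eqF.
  (* An unbound variable is read from register 0, whose value is also the default of [eval]. *)
  + rewrite /upd eqxx; case: (ltnP i (size rho)) => h; first by rewrite (nth_map 0).
    by rewrite !nth_default ?size_map.
  + by move=> k kn; rewrite /upd (ltn_eqF kn).
- exists (upd R n (R 0)), 1; split=> //; first exact: ExecCopy.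
  + by rewrite /upd eqxx.
  + by move=> k kn; rewrite /upd (ltn_eqF kn).
- have [R1 [s1 [E1 b1 v1 f1]]] := IHa rho n R n_gt0 lt_rho R0.
  exists (upd R1 n (R1 n).+1), (s1 + 1); split.
  + by apply: ExecSeq E1 _; apply: ExecInc.
  + by rewrite leq_add2r.
  + by rewrite /upd eqxx v1.
  + by move=> k kn; rewrite /upd (ltn_eqF kn) f1.
- have [R1 [s1 [E1 b1 v1 f1]]] := IHa rho n R n_gt0 lt_rho R0.
  have lt_rho' : all (fun r => r < n.+1) rho.
    by apply: sub_all lt_rho => r /ltnW; rewrite ltnS.
  have [R2 [s2 [E2 b2 v2 f2]]] := IHb rho n.+1 R1 isT lt_rho' (exec_zero E1 R0).
  have [R3 [s3 [E3 b3 v3 f3]]] := @exec_bool w n R2 (TLt n n.+1) n_gt0 (exec_zero E2 (exec_zero E1 R0)).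
  exists R3, (s1 + (s2 + s3)); split.
  + by apply: ExecSeq E1 (ExecSeq E2 E3).
  + by rewrite addnA !leq_add.
  + by rewrite v3 /= f2 // v1 v2 (eq_map_lt lt_rho f1).
  + by move=> k kn; rewrite f3 // f2 ?f1 // ltnW.
- have [R1 [s1 [E1 b1 v1 f1]]] := IHa rho n R n_gt0 lt_rho R0.
  have [R3 [s3 [E3 b3 v3 f3]]] := @exec_bool w n R1 (TBit n) n_gt0 (exec_zero E1 R0).
  exists R3, (s1 + s3); split.
  + by apply: ExecSeq E1 E3.
  + by rewrite leq_add.
  + by rewrite v3 /= v1.
  + by move=> k kn; rewrite f3 // f1.
- have [R1 [s1 [E1 b1 v1 f1]]] := IHc rho n R n_gt0 lt_rho R0.
  have R10 := exec_zero E1 R0.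
  have [Ra [sa [Ea ba va fa]]] := IHa rho n R1 n_gt0 lt_rho R10.
  have [Rb [sb [Eb bb vb fb]]] := IHb rho n R1 n_gt0 lt_rho R10.
  rewrite !(eq_map_lt lt_rho f1) in va vb.
  case tt: (0 < eval w c [seq R i | i <- rho]).
    exists Ra, (s1 + sa.+1); split=> //; last by move=> k kn; rewrite fa // f1.
      by apply: ExecSeq E1 (ExecThen _ _ Ea); rewrite /= R10 v1.
    by lia.
  exists Rb, (s1 + sb.+1); split=> //; last by move=> k kn; rewrite fb // f1.
    by apply: ExecSeq E1 (ExecElse _ _ Eb); rewrite /= R10 v1 tt.
  by lia.
- have [R1 [s1 [E1 b1 v1 f1]]] := IHa rho n R n_gt0 lt_rho R0.
  have lt_rho' : all (fun r => r < n.+1) (n :: rho).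
    by rewrite /= ltnSn; apply: sub_all lt_rho => r /ltnW; rewrite ltnS.
  have [R2 [s2 [E2 b2 v2 f2]]] := IHb (n :: rho) n.+1 R1 isT lt_rho' (exec_zero E1 R0).
  exists (upd R2 n (R2 n.+1)), (s1 + (s2 + 1)); split.
  + apply: ExecSeq E1 (ExecSeq E2 _); apply: ExecCopy => //.
    by rewrite neq_ltn ltnSn.
  + by rewrite addnA !leq_add.
  + by rewrite /upd eqxx v2 /= v1 (eq_map_lt lt_rho f1).
  + by move=> k kn; rewrite /upd (ltn_eqF kn) f2 ?f1 // ltnW.
- have lt_vs : all (fun r => r < n) [seq nth 0 rho i | i <- vs].
    by rewrite all_map; apply/allP => i _ /=; apply: nth_all_lt.
  have [R1 [s1 [E1 b1 v1 f1]]] := IHa _ n R n_gt0 lt_vs R0.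
  exists R1, s1; split=> //; rewrite v1 -map_comp; congr eval.
  apply: eq_map => i /=; case: (ltnP i (size rho)) => h; first by rewrite (nth_map 0).
  by rewrite !nth_default ?size_map.
- have [R1 [s1 [E1 b1 v1 f1]]] := IHa rho n R n_gt0 lt_rho R0.
  set env := map R rho.
  set body := fun acc i => eval w b [:: i, acc & env].
  have nSn : (n == n.+1) = false by rewrite ltn_eqF.
  (* [q] counts the iterations still to come; the counter holds [size w - q], so [TIn] fails exactly
     at [q = 0]. *)
  have loop : forall q, q <= size w -> forall R2 : nat -> nat, R2 n.+1 = size w - q ->
      R2 0 = 0 -> (forall k, k < n -> R2 k = R k) ->
      exists R3 s3, [/\ exec w (While (TIn n.+1) (Seq (compile b [:: n.+1, n & rho] n.+2)
                             (Seq (Copy n n.+2) (Inc n.+1)))) R2 R3 s3,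
        s3 <= q * (cost b (size w) + 3) + 1,
        R3 n = foldl body (R2 n) (iota (size w - q) q) &
        forall k, k < n -> R3 k = R k].
    elim=> [|q IH] qw R2 R2i R20 R2f.
      exists R2, 1; split=> //.
      by apply: ExecDone; rewrite /= R2i subn0 ltnn.
    have lt_rho' : all (fun r => r < n.+2) [:: n.+1, n & rho].
      rewrite /= leqnn leqnSn; apply: sub_all lt_rho => r rn.
      by rewrite ltnS ltnW // ltnW.
    have [R4 [s4 [E4 b4 v4 f4]]] := IHb [:: n.+1, n & rho] n.+2 R2 isT lt_rho' R20.
    pose R5 := upd R4 n (R4 n.+2).
    pose R6 := upd R5 n.+1 (R5 n.+1).+1.
    have step : exec w (Seq (compile b [:: n.+1, n & rho] n.+2) (Seq (Copy n n.+2) (Inc n.+1)))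
        R2 R6 (s4 + (1 + 1)).
      apply: ExecSeq E4 (ExecSeq (R2 := R5) _ _).
        by apply: ExecCopy => //; rewrite neq_ltn ltnW.
      exact: ExecInc.
    have R6f k : k < n -> R6 k = R k.
      move=> kn; rewrite /R6 /R5 /upd (ltn_eqF (ltnW _)) // (ltn_eqF kn) f4 ?R2f //.
      by rewrite ltnW // ltnW.
    have R6i : R6 n.+1 = size w - q.
      rewrite /R6 /R5 /upd !eqxx (gtn_eqF (ltnSn n)) f4 // R2i.
      by rewrite subnSK.
    have [R7 [s7 [E7 b7 v7 f7]]] := IH (ltnW qw) R6 R6i (exec_zero step R20) R6f.
    exists R7, (s4 + (1 + 1) + s7).+1; split=> //.
    + by apply: ExecLoop step E7; rewrite /= R2i; lia.
    + by rewrite mulSn; lia.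
    + rewrite v7 -(subnSK qw) /=; congr foldl.
      rewrite /R6 /R5 /upd nSn eqxx v4 /= R2i /body (eq_map_lt lt_rho R2f) //.
  pose R2 := upd R1 n.+1 0; have R10 := exec_zero E1 R0.
  have [|||R3 [s3 [E3 b3 v3 f3]]] := loop (size w) (leqnn _) R2.
  + by rewrite /R2 /upd eqxx subnn.
  + by rewrite /R2 /upd /= R10.
  + by move=> k kn; rewrite /R2 /upd (ltn_eqF (ltnW _)) ?f1.
  exists R3, (s1 + (1 + s3)); split=> //.
  + apply: ExecSeq E1 (ExecSeq _ E3); rewrite /R2 -[X in upd _ _ X]R10.
    exact: ExecCopy.
  + by lia.
  + by rewrite v3 subnn /R2 /upd nSn v1.
Qed.

(** * Polynomial bounds and the resulting machine *)

Definition poly_bounded (f : nat -> nat) :=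
  exists c d, forall n, f n <= c * n ^ d + c.

Lemma poly_bounded_const c : poly_bounded (fun=> c).
Proof. by exists c, 0 => n; lia. Qed.

Lemma poly_bounded_id : poly_bounded id.
Proof. by exists 1, 1 => n; lia. Qed.

(** The [+ 1] is for [n = 0], where [0 ^ 0 = 1] exceeds [0 ^ b] for positive [b]. *)
Lemma leq_exp_add n a b : n ^ a <= n ^ (a + b) + 1.
Proof.
case: n => [|n]; first by case: a => [|a]; [rewrite leq_addl | rewrite exp0n].
by rewrite (leq_trans (leq_pexp2l _ (leq_addr b a))) // leq_addr.
Qed.

Lemma poly_bounded_add f g :
  poly_bounded f -> poly_bounded g -> poly_bounded (fun n => f n + g n).
Proof.
move=> [c1 [d1 b1]] [c2 [d2 b2]]; exists (c1 + c1 + (c2 + c2)), (d1 + d2) => n.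
have := b1 n; have := b2 n; have := leq_exp_add n d1 d2; have := leq_exp_add n d2 d1.
by rewrite (addnC d2); nia.
Qed.

Lemma poly_bounded_mul f g :
  poly_bounded f -> poly_bounded g -> poly_bounded (fun n => f n * g n).
Proof.
move=> [c1 [d1 b1]] [c2 [d2 b2]]; exists (4 * (c1 * c2)), (d1 + d2) => n.
apply: leq_trans (leq_mul (b1 n) (b2 n)) _.
have := leq_exp_add n d1 d2; have := leq_exp_add n d2 d1.
rewrite (addnC d2) expnD; set x := n ^ d1; set y := n ^ d2 => yb xb.
have -> : (c1 * x + c1) * (c2 * y + c2) = c1 * c2 * ((x + 1) * (y + 1)) by lia.
have -> : 4 * (c1 * c2) * (x * y) + 4 * (c1 * c2) = c1 * c2 * (4 * (x * y) + 4) by lia.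
(* Both [x] and [y] are at most [x * y + 1], which bounds [(x + 1) * (y + 1)] by
   [4 * (x * y + 1)]. *)
by rewrite leq_mul2l; apply/orP; right; lia.
Qed.

Lemma poly_bounded_leq f g :
  (forall n, f n <= g n) -> poly_bounded g -> poly_bounded f.
Proof. by move=> fg [c [d b]]; exists c, d => n; apply: leq_trans (fg n) _. Qed.

Lemma poly_bounded_cost e : poly_bounded (cost e).
Proof.
elim: e => [i||a IHa|a IHa b IHb|a IHa|c IHc a IHa b IHb|a IHa b IHb|vs a IHa|a IHa b IHb] //=;
  repeat first [assumption | exact: poly_bounded_const | exact: poly_bounded_id
               | apply: poly_bounded_add | apply: poly_bounded_mul].
Qed.

Lemma halted_iter M (c : tm_config M) n : tm_halted c -> iter n (@tm_step M) c = c.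
Proof.
move=> hc; elim: n => //= n ->; case: c hc => [[q h] t] /=.
by case: (tm_delta q (t h)).
Qed.

Theorem exp_polytime e : exists (M : TM) (c d : nat), forall w,
  let cfg := tm_run M (c * size w ^ d + c) w in
  tm_halted cfg /\ tm_accepts cfg = (0 < eval w e [::]).
Proof.
pose body := compile e [::] 1; pose m := maxn 1 (reg_bound body).
pose n1 := (code_size body).+1.
(* The first step puts all marks on the origin, so that every register is 0. *)
pose start : instr m := fun a => ((a.1, setT), true, 1).
(* The final test jumps past the end of [P], where no transition is defined: to [n1 + 4], which
   rejects, or to the next state, the only accepting one. *)
pose P := start :: gen m body 1 n1 ++ gen_test m (TLt 0 1) n1 (n1 + 4).+1 (n1 + 4).
have sizeP : size P = n1 + 4 by rewrite /= size_cat size_gen addSn.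
have [c [d bound]] : poly_bounded
    (fun N => 1 + (cost e N * (8 * (cost e N).+1) + 8 * (cost e N).+1)).
  have ce := poly_bounded_cost e.
  have c8 : poly_bounded (fun N => 8 * (cost e N).+1).
    apply: poly_bounded_leq (poly_bounded_mul (poly_bounded_const 8) (poly_bounded_add ce (poly_bounded_const 1))).
    by move=> n; rewrite addn1.
  apply: poly_bounded_add (poly_bounded_const 1) _.
  exact: poly_bounded_add (poly_bounded_mul ce c8) c8.
exists (machine P), c, d => w.
have [R' [s [E sb v _]]] := @exec_compile w e [::] 1 (fun=> 0) isT isT (erefl 0).
have r0 : runs P w 1 0 0 (fun=> None) 1 1 (located (fun=> 0)).
  move=> [[q h] t] [/= qE hE tE].
  rewrite /= qE /= hE tE; split => /=.
  - by rewrite inordK // sizeP.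
  - by [].
  - move=> z; case: eqP => [->|/eqP nz]; first rewrite encode_symK.
      by congr pair; apply/setP => i; rewrite !inE.
    by rewrite tE; case: z nz => //= k nz; congr pair; apply/setP => i; rewrite !inE; case: k nz.
have cs1 : code_at P 1 (gen m body 1 n1).
  by exists [:: start], (gen_test m (TLt 0 1) n1 (n1 + 4).+1 (n1 + 4)).
have cs2 : code_at P n1 (gen_test m (TLt 0 1) n1 (n1 + 4).+1 (n1 + 4)).
  exists (start :: gen m body 1 n1), [::]; rewrite cats0; split=> //.
  by rewrite /= size_gen.
have bm : reg_bound body <= m by rewrite leq_maxr.
have [|||t1 b1 r1] := runs_gen (M := cost e (size w)) E (X := 0) cs1 _ (erefl 0) bm _ _ (erefl _); rewrite ?sizeP //; try lia.
have [|||t2 b2] := runs_test w cs2 _ _ (exec_zero E (erefl 0)) _ (exec_growth E (X := 0) (fun=> leqnn 0)); rewrite ?sizeP //; try lia.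
  by rewrite /m leq_max.
rewrite /= v (exec_zero E (erefl 0)) /= => r2.
set T := c * size w ^ d + c.
have leT : 1 + (t1 + t2) <= T.
  apply: leq_trans (bound (size w)); rewrite leq_add2l leq_add //.
    by apply: leq_trans b1 _; rewrite leq_mul2r sb orbT.
  by apply: leq_trans b2 _; rewrite leq_mul2l /= ltnS.
have rep0 : represents w 0 0 (fun=> None) (tm_init (machine P) w).
  split=> //= z; case: z => [p|p] /=; last first.
    by rewrite /decode /=; congr pair.
  have zero : [set i : 'I_m.+1 | None == Some p] = set0 by apply/setP => i; rewrite !inE.
  rewrite zero {zero}; case: ltnP => h; last first.
    by rewrite /decode /=; congr pair; elim: (w) p h => [|b w' IH] [|p] //=; apply: IH.
  rewrite /tm_bit /decode; have -> : onth w p = Some (nth false w p).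
    by elim: (w) p h => [|b w' IH] [|p] //= /IH.
  by case: (nth false w p); rewrite /= inordK.
rewrite /tm_run -(subnK leT) iterD; move: (runs_trans r0 (runs_trans r1 r2) rep0).
set cfg := iter (1 + (t1 + t2)) _ _ => -[pcE _ _].
have hcfg : tm_halted cfg.
  by rewrite machine_halted [nat_of_ord _]pcE sizeP; case: ifP.
rewrite halted_iter // machine_accepts pcE sizeP; split=> //.
by case: (0 < _); rewrite ?eqxx // ltn_eqF.
Qed.

(** * Computable functions of the input word *)

(* [f w x] is computed by an expression whose variables hold the values at [x]
   of the functions [xs]. *)
Definition computable X (xs : seq (X -> nat)) (f : seq bool -> X -> nat) :=
  exists e, forall w x, eval w e [seq v x | v <- xs] = f w x.

Definition computableb X (xs : seq (X -> nat)) (p : seq bool -> X -> bool) :=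
  computable xs (fun w x => p w x : nat).

Lemma comp_reindex X Y (xs : seq (X -> nat)) (ys : seq (Y -> nat)) (h : Y -> X) f :
  (forall y, [seq v y | v <- ys] = [seq v (h y) | v <- xs]) ->
  computable xs f -> computable ys (fun w y => f w (h y)).
Proof. by move=> eq_h [e E]; exists e => w y; rewrite eq_h E. Qed.

Section Closure.
Variables (X : Type) (xs : seq (X -> nat)).
Implicit Types (f a b : seq bool -> X -> nat) (p q r : seq bool -> X -> bool).

Lemma comp_ext f g : (forall w x, f w x = g w x) -> computable xs f -> computable xs g.
Proof. by move=> fg [e E]; exists e => w x; rewrite E fg. Qed.

Lemma comp_head v : computable (v :: xs) (fun _ x => v x).
Proof. by exists (Var 0). Qed.

Lemma map_nth_iota1 (v0 : nat) (s : seq nat) :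
  [seq nth 0 (v0 :: s) i | i <- iota 1 (size s)] = s.
Proof.
rewrite (iotaDl 1 0) -map_comp -[RHS](mkseq_nth 0).
by apply: eq_map => i.
Qed.

Lemma map_nth_iota0 (s : seq nat) : [seq nth 0 s i | i <- iota 0 (size s)] = s.
Proof. exact: mkseq_nth. Qed.

Lemma comp_tail v f : computable xs f -> computable (v :: xs) f.
Proof.
move=> [e E]; exists (With (iota 1 (size xs)) e) => w x.
by rewrite -E /= -[size xs](size_map (fun u : X -> nat => u x)) map_nth_iota1.
Qed.

Lemma comp_const n : computable xs (fun _ _ => n).
Proof. by elim: n => [|n [e E]]; [exists Zero | exists (Succ e) => w x /=; rewrite E]. Qed.

Lemma comp_succ f : computable xs f -> computable xs (fun w x => (f w x).+1).
Proof. by move=> [e E]; exists (Succ e) => w x /=; rewrite E. Qed.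

Lemma comp_if p a b : computableb xs p -> computable xs a -> computable xs b ->
  computable xs (fun w x => if p w x then a w x else b w x).
Proof.
move=> [ep Ep] [ea Ea] [eb Eb]; exists (If ep ea eb) => w x /=.
by rewrite Ep Ea Eb lt0b.
Qed.

Lemma compb_lt a b : computable xs a -> computable xs b -> computableb xs (fun w x => a w x < b w x).
Proof. by move=> [ea Ea] [eb Eb]; exists (Lt ea eb) => w x /=; rewrite Ea Eb. Qed.

Lemma compb_leq a b : computable xs a -> computable xs b -> computableb xs (fun w x => a w x <= b w x).
Proof. by move=> Ha Hb; apply: compb_lt Ha (comp_succ Hb). Qed.

Lemma compb_bit a : computable xs a -> computableb xs (fun w x => nth false w (a w x)).
Proof. by move=> [ea Ea]; exists (Bit ea) => w x /=; rewrite Ea. Qed.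

Lemma compb_const (b : bool) : computableb xs (fun _ _ => b).
Proof. exact: (comp_const b). Qed.

Lemma compb_if p q r : computableb xs p -> computableb xs q -> computableb xs r ->
  computableb xs (fun w x => if p w x then q w x else r w x).
Proof.
by move=> Hp Hq Hr; apply: comp_ext (comp_if Hp Hq Hr) => w x; case: (p w x).
Qed.

Lemma compb_neg p : computableb xs p -> computableb xs (fun w x => ~~ p w x).
Proof.
by move=> Hp; apply: (comp_ext _ (compb_if Hp (compb_const false) (compb_const true))).
Qed.

Lemma compb_and p q : computableb xs p -> computableb xs q -> computableb xs (fun w x => p w x && q w x).
Proof. by move=> Hp Hq; apply: (comp_ext _ (compb_if Hp Hq (compb_const false))). Qed.

Lemma compb_or p q : computableb xs p -> computableb xs q -> computableb xs (fun w x => p w x || q w x).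
Proof. by move=> Hp Hq; apply: (comp_ext _ (compb_if Hp (compb_const true) Hq)). Qed.

Lemma compb_imply p q : computableb xs p -> computableb xs q -> computableb xs (fun w x => p w x ==> q w x).
Proof. by move=> Hp Hq; apply: (comp_ext _ (compb_if Hp Hq (compb_const true))). Qed.

Lemma compb_eqb p q : computableb xs p -> computableb xs q -> computableb xs (fun w x => p w x == q w x).
Proof.
move=> Hp Hq; apply: (comp_ext _ (compb_if Hp Hq (compb_neg Hq))) => w x.
by case: (p w x); case: (q w x).
Qed.

Lemma compb_eqn a b : computable xs a -> computable xs b -> computableb xs (fun w x => a w x == b w x).
Proof.
move=> Ha Hb; apply: (comp_ext _ (compb_and (compb_leq Ha Hb) (compb_leq Hb Ha))) => w x.
by rewrite eqn_leq.
Qed.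

Definition loop_vars : seq (X * (nat * nat) -> nat) :=
  (fun y => y.2.1) :: (fun y => y.2.2) :: [seq (fun y => v y.1) | v <- xs].

Lemma comp_fold (b : seq bool -> X -> nat -> nat -> nat) a :
  computable loop_vars (fun w y => b w y.1 y.2.1 y.2.2) -> computable xs a ->
  computable xs (fun w x => foldl (fun acc i => b w x i acc) (a w x) (iota 0 (size w))).
Proof.
move=> [eb Eb] [ea Ea]; exists (Loop ea eb) => w x /=; rewrite Ea.
elim: (iota 0 (size w)) (a w x) => //= i s IH acc.
by rewrite IH -(Eb w (x, (i, acc))) /= -map_comp.
Qed.

Lemma compb_fold (p : seq bool -> X -> nat -> bool -> bool) q :
  computableb loop_vars (fun w y => p w y.1 y.2.1 (0 < y.2.2)) -> computableb xs q ->
  computableb xs (fun w x => foldl (fun acc i => p w x i acc) (q w x) (iota 0 (size w))).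
Proof.
move=> Hp Hq.
apply: (comp_ext _ (comp_fold (b := fun w x i acc => p w x i (0 < acc) : nat) Hp Hq)) => w x.
by elim: (iota 0 (size w)) (q w x) => //= i s IH []; rewrite /= IH.
Qed.

End Closure.
Arguments comp_const {X xs}.
Arguments compb_const {X xs}.

Section Loops.
Variables (X : Type) (xs : seq (X -> nat)).
Implicit Types (f a b : seq bool -> X -> nat).
Local Notation loop_vars := (loop_vars xs).

Definition index_vars : seq (X * nat -> nat) :=
  (fun y => y.2) :: [seq (fun y => v y.1) | v <- xs].

Lemma comp_index_acc (f : seq bool -> X -> nat -> nat) :
  computable index_vars (fun w y => f w y.1 y.2) ->
  computable loop_vars (fun w y => f w y.1 y.2.2).
Proof.
move=> H; apply: comp_tail; apply: (comp_reindex (h := fun y => (y.1, y.2.2)) _ H).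
by move=> y /=; rewrite -!map_comp.
Qed.

Lemma comp_index (f : seq bool -> X -> nat -> nat) :
  computable index_vars (fun w y => f w y.1 y.2) ->
  computable loop_vars (fun w y => f w y.1 y.2.1).
Proof.
move=> [e E]; exists (With (0 :: iota 2 (size xs)) e) => w y /=.
rewrite -(E w (y.1, y.2.1)) /= -!map_comp /= (iotaDl 2 0) -map_comp.
congr eval; congr cons; rewrite -[RHS]map_nth_iota0 size_map.
by apply: eq_map => i.
Qed.

Lemma comp_lift f : computable xs f -> computable loop_vars (fun w y => f w y.1).
Proof.
move=> H; apply: comp_tail; apply: comp_tail.
by apply: (comp_reindex (h := fst) _ H) => y; rewrite -map_comp.
Qed.

Lemma comp_acc : computable loop_vars (fun _ y => y.2.2).
Proof. by exists (Var 1). Qed.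

Lemma comp_count (p : seq bool -> X -> nat -> bool) :
  computableb index_vars (fun w y => p w y.1 y.2) ->
  computable xs (fun w x => count (fun i => p w x i) (iota 0 (size w))).
Proof.
move=> Hp.
apply: (comp_ext _ (comp_fold (b := fun w x i acc => if p w x i then acc.+1 else acc) _ (comp_const 0))).
  move=> w x; rewrite -[RHS]add0n.
  move: (iota 0 (size w)) => l; elim: l 0 => [|i s IH] n /=; first by rewrite addn0.
  by rewrite IH; case: (p w x i); rewrite ?add0n // addSnnS.
apply: comp_if; [exact: (comp_index (f := fun w x i => p w x i : nat) Hp)
  | exact: comp_succ comp_acc | exact: comp_acc].
Qed.

Lemma compb_has (p : seq bool -> X -> nat -> bool) :
  computableb index_vars (fun w y => p w y.1 y.2) ->
  computableb xs (fun w x => has (fun i => p w x i) (iota 0 (size w))).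
Proof.
move=> /comp_count H; apply: (comp_ext _ (compb_lt (comp_const 0) H)) => w x.
by rewrite has_count.
Qed.

Lemma compb_all (p : seq bool -> X -> nat -> bool) :
  computableb index_vars (fun w y => p w y.1 y.2) ->
  computableb xs (fun w x => all (fun i => p w x i) (iota 0 (size w))).
Proof.
move=> /compb_neg Hp.
apply: (comp_ext _ (compb_neg (compb_has (p := fun w x i => ~~ p w x i) Hp))) => w x.
by rewrite has_predC negbK.
Qed.

(** The loop runs [size w] times and idles from round [n w x] on. This is the origin of [minn] in
    the iterations of the procedure. *)
Lemma comp_iter (f : seq bool -> X -> nat -> nat) n a :
  computable index_vars (fun w y => f w y.1 y.2) -> computable xs n -> computable xs a ->
  computable xs (fun w x => iter (minn (n w x) (size w)) (f w x) (a w x)).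
Proof.
move=> Hf Hn Ha.
apply: (comp_ext _ (comp_fold (b := fun w x i acc => if i < n w x then f w x acc else acc) _ Ha)).
  move=> w x; move: (a w x) => acc; set m := minn _ _; have mn : m <= n w x by apply: geq_minl.
  have low k : k <= n w x ->
      foldl (fun acc i => if i < n w x then f w x acc else acc) acc (iota 0 k) = iter k (f w x) acc.
    elim: k => [//|k IH] kn; rewrite -{1}addn1 iotaD foldl_cat IH 1?ltnW //= add0n.
    by rewrite kn.
  have mE : m < n w x -> m = size w by rewrite /m; lia.
  have mw : m <= size w by apply: geq_minr.
  have [/mE <-|nm] := ltnP m (n w x); first exact: low.
  rewrite -(subnKC mw) iotaD foldl_cat add0n.
  rewrite low //; move: (iter m _ _) (size w - m) => acc' k.
  have: all (fun i => n w x <= i) (iota m k).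
    by apply/allP => i; rewrite mem_iota => /andP[mi _]; apply: leq_trans nm mi.
  by elim: (iota m k) => //= i s IH /andP[]; rewrite leqNgt => /negbTE ->.
apply: comp_if; [ | exact: comp_index_acc Hf | exact: comp_acc].
apply: compb_lt; [exact: comp_head | exact: comp_lift].
Qed.

(** Addition is iterated successor, and a loop offers only [size w] rounds; hence the bound on
    [b]. *)
Lemma comp_add a b : (forall w x, b w x <= size w) -> computable xs a -> computable xs b ->
  computable xs (fun w x => a w x + b w x).
Proof.
move=> bN Ha Hb.
apply: (comp_ext _ (comp_iter (f := fun _ _ i => i.+1) (comp_succ (comp_head _ _)) Hb Ha)).
by move=> w x; rewrite (minn_idPl (bN w x)); elim: (b w x) => [|n IH]; rewrite ?addn0 // addnS -IH.
Qed.

End Loops.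
Arguments comp_acc {X xs}.

Lemma comp_sum X (xs : seq (X -> nat)) (f : seq bool -> X -> nat -> nat) :
  (forall w x i, f w x i <= size w) -> computable (index_vars xs) (fun w y => f w y.1 y.2) ->
  computable xs (fun w x => \sum_(i <- iota 0 (size w)) f w x i).
Proof.
move=> fN Hf.
apply: (comp_ext _ (comp_fold (b := fun w x i acc => acc + f w x i) _ (comp_const 0))).
  move=> w x; rewrite -[RHS]add0n; move: (iota 0 (size w)) => l.
  suff fold_sum n : foldl (fun acc i => acc + f w x i) n l = n + \sum_(i <- l) f w x i.
    exact: fold_sum.
  elim: l n => [|i l IH] n /=; first by rewrite big_nil addn0.
  by rewrite IH big_cons addnA.
apply: comp_add => //; [exact: comp_acc | exact: comp_index Hf].
Qed.

Lemma comp_size X (xs : seq (X -> nat)) : computable xs (fun w _ => size w).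
Proof.
apply: (comp_ext _ (comp_count (p := fun _ _ _ => true) (compb_const true))) => w x.
by rewrite count_predT size_iota.
Qed.

Definition computable0 (F : seq bool -> nat) := computable [::] (fun w (_ : unit) => F w).
Definition computable1 (F : seq bool -> nat -> nat) := computable [:: id] F.
Definition computable2 (F : seq bool -> nat -> nat -> nat) :=
  computable [:: fst; snd] (fun w x => F w x.1 x.2).

Section Calls.
Variables (X : Type) (xs : seq (X -> nat)).

Lemma comp_call0 F : computable0 F -> computable xs (fun w _ => F w).
Proof. by move=> [e E]; exists (With [::] e) => w x /=; apply: (E w tt). Qed.

Lemma comp_call1 F a : computable1 F -> computable xs a -> computable xs (fun w x => F w (a w x)).
Proof.
by move=> [e E] [ea Ea]; exists (Let ea (With [:: 0] e)) => w x /=; rewrite Ea; apply: E.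
Qed.

Lemma comp_call2 F a b : computable2 F -> computable xs a -> computable xs b ->
  computable xs (fun w x => F w (a w x) (b w x)).
Proof.
move=> [e E] [ea Ea] [eb Eb].
(* The second argument is evaluated below the binding of the first, which [iota 1] skips;
   [[:: 1; 0]] restores the order, the latest binding being variable 0. *)
exists (Let ea (Let (With (iota 1 (size xs)) eb) (With [:: 1; 0] e))) => w x /=.
rewrite Ea -[X in eval w e [:: _; eval w eb [seq _ | i <- iota 1 X]]](size_map (fun u : X -> nat => u x)).
by rewrite map_nth_iota1 Eb; apply: (E w (_, _)).
Qed.

End Calls.

(** * The decision procedure *)

Section Algorithm.
Variable w : seq bool.
Local Notation N := (size w).
Local Notation bit := (nth false w).
Local Notation upto := (iota 0 N).

(* A reading position is moved over one element of a list, whose elements are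
   announced by [true]; it stays put on the closing [false]. *)
Definition nat_next p := if bit p then p.+2 else p.
(** [N] rounds are enough to reach the end of any list in the word; [minn N N] has the form that
    [comp_iter] provides. Two closing bits follow a number, one follows a list. *)
Definition nat_end p := (iter (minn N N) nat_next p).+2.
Definition nat_tag p k := iter (minn k N) nat_next p.
(** Beyond the last digit the tag is [false], so the number is extended by leading zeros. *)
Definition nat_bit p k := bit (nat_tag p k) && bit (nat_tag p k).+1.
Definition int_end p := nat_end p.+1.
Definition cell_next p := if bit p then int_end (int_end p.+1) else p.
Definition cells_end p := (iter (minn N N) cell_next p).+1.
Definition cell_elt p i := iter (minn i N) cell_next p.
Definition piece_next p := if bit p then cells_end p.+1 else p.
(* The word lists the frame, the pieces, the target and the goal in this order. *)
Definition pieces_at := cells_end 0.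
Definition piece_elt j := iter (minn j N) piece_next pieces_at.
Definition target_at := (iter (minn N N) piece_next pieces_at).+1.
Definition goal_at := nat_end target_at.

Definition nat_lt p q :=
  foldl (fun acc k => if nat_bit p k == nat_bit q k then acc else nat_bit q k)
        false upto.
Definition int_lt p q :=
  if bit p then (if bit q then nat_lt q.+1 p.+1 else true)
  else (if bit q then false else nat_lt p.+1 q.+1).
Definition cell_lt p q := int_lt p q || int_lt (int_end p) (int_end q).

Definition parity n := foldl (fun acc k => if k < n then ~~ acc else acc) false upto.
(** There are [n./2] odd numbers below [n]. *)
Definition halve n := count (fun k => (k < n) && parity k) upto.
(** The index [j] is a register value and the target is a binary numeral in the word, so the digits
    of [j] are produced by repeated halving. *)
Definition is_target j :=
  all (fun k => parity (iter (minn k N) halve j) == nat_bit target_at k) upto.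

Definition cells_len p := count (fun i => bit (cell_elt p i)) upto.
Definition frame_len := cells_len 0.
Definition piece_len j :=
  if bit (piece_elt j) then cells_len (piece_elt j).+1 else 0.
Definition total_len := \sum_(j <- upto) piece_len j.
(** The comparison of [piece_len j] with the number of free cells, written without subtraction. *)
Definition is_big j := frame_len < total_len + piece_len j.

(** The frame may be listed in any order, so the offset is a count of the frame cells lying before
    all cells of the list. *)
Definition list_pos p :=
  count (fun i => bit (cell_elt 0 i) &&
    all (fun k => bit (cell_elt p k) ==>
                  cell_lt (cell_elt 0 i).+1 (cell_elt p k).+1) upto) upto.
Definition piece_pos j := list_pos (piece_elt j).+1.

Definition left_len c := \sum_(j <- upto)
  if is_big j && ~~ is_target j && (piece_pos j < c) then piece_len j else 0.
Definition right_len c := \sum_(j <- upto)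
  if is_big j && ~~ is_target j && (c <= piece_pos j) then piece_len j else 0.
Definition good_cut c :=
  [&& left_len c <= list_pos goal_at,
      right_len c + cells_len goal_at + list_pos goal_at <= frame_len &
      all (fun j => is_target j && bit (piece_elt j) && is_big j ==>
                    (piece_pos j == c)) upto].
Definition solve := has good_cut upto.

Lemma cells_len_leq p : cells_len p <= N.
Proof. by apply: leq_trans (count_size _ _) _; rewrite size_iota. Qed.

Lemma piece_len_leq j : piece_len j <= N.
Proof. by rewrite /piece_len; case: ifP => // _; apply: cells_len_leq. Qed.

Lemma list_pos_leq p : list_pos p <= N.
Proof. by apply: leq_trans (count_size _ _) _; rewrite size_iota. Qed.

End Algorithm.

Create HintDb computable.

(* Every goal is stated with both abstractions explicit so that [comp_step] can
   match on the head symbol of the body. *)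
Ltac eta_goal :=
  lazymatch goal with
  | |- computable ?xs ?f =>
    let g := eval cbv beta in (fun w x => f w x) in change (computable xs g)
  | |- computableb ?xs ?f =>
    let g := eval cbv beta in (fun w x => f w x) in change (computableb xs g)
  end.

Ltac comp_var := solve [repeat first [exact: comp_head | apply: comp_tail]].

Ltac comp_step :=
  eta_goal;
  lazymatch goal with
  | |- computable ?xs (fun w x => nat_of_bool (@?p w x)) => change (computableb xs p)
  | |- computableb _ (fun w x => nth _ _ _) => apply: compb_bit
  | |- computableb _ (fun w x => leq (S _) _) => apply: compb_lt
  | |- computableb _ (fun w x => leq _ _) => apply: compb_leq
  | |- computableb _ (fun w x => andb _ _) => apply: compb_and
  | |- computableb _ (fun w x => orb _ _) => apply: compb_or
  | |- computableb _ (fun w x => negb _) => apply: compb_neg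
  | |- computableb _ (fun w x => implb _ _) => apply: compb_imply
  | |- computableb _ (fun w x => eq_op _ _) =>
    first [apply: compb_eqb | apply: compb_eqn]
  | |- computableb _ (fun w x => if _ then _ else _) => apply: compb_if
  | |- computableb _ (fun w x => has _ _) => apply: compb_has
  | |- computableb _ (fun w x => all _ _) => apply: compb_all
  | |- computableb _ (fun w x => foldl _ _ _) => apply: compb_fold
  | |- computableb _ (fun w x => true) => exact: compb_const
  | |- computableb _ (fun w x => false) => exact: compb_const
  | |- computable _ (fun w x => if _ then _ else _) => apply: comp_if
  | |- computable _ (fun w x => count _ _) => apply: comp_count
  | |- computable _ (fun w x => iter _ _ _) => apply: comp_iter
  | |- computable _ (fun w x => bigop _ _ _) => apply: comp_sum
  | |- computable _ (fun w x => addn _ _) => apply: comp_add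
  | |- computable _ (fun w x => size _) => exact: comp_size
  | |- computable _ (fun w x => O) => exact: comp_const
  | |- computable _ (fun w x => S _) => apply: comp_succ
  | |- computable _ (fun w x => ?F w) =>
    apply: (@comp_call0 _ _ F); solve [auto with computable nocore]
  | |- computable _ (fun w x => ?F w _) =>
    apply: (@comp_call1 _ _ F); [solve [auto with computable nocore] | ]
  | |- computable _ (fun w x => ?F w _ _) =>
    apply: (@comp_call2 _ _ F); [solve [auto with computable nocore] | | ]
  | |- computableb _ (fun w x => ?F w _) =>
    let G := constr:(fun w p => nat_of_bool (F w p)) in
    apply: (@comp_call1 _ _ G); [solve [auto with computable nocore] | ]
  | |- computableb _ (fun w x => ?F w _ _) =>
    let G := constr:(fun w p q => nat_of_bool (F w p q)) in
    apply: (@comp_call2 _ _ G); [solve [auto with computable nocore] | | ]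
  | |- computable _ _ => comp_var
  end.
Ltac comp_auto := repeat comp_step.

Lemma comp_nat_next : computable1 nat_next.
Proof. by rewrite /computable1 /nat_next; comp_auto. Qed.
#[local] Hint Resolve comp_nat_next : computable.

Lemma comp_nat_end : computable1 nat_end.
Proof. by rewrite /computable1 /nat_end; comp_auto. Qed.
#[local] Hint Resolve comp_nat_end : computable.

Lemma comp_nat_tag : computable2 nat_tag.
Proof. by rewrite /computable2 /nat_tag; comp_auto. Qed.
#[local] Hint Resolve comp_nat_tag : computable.

Lemma comp_nat_bit : computable2 (fun w p q => nat_bit w p q : nat).
Proof. by rewrite /computable2 /nat_bit; comp_auto. Qed.
#[local] Hint Resolve comp_nat_bit : computable.

Lemma comp_int_end : computable1 int_end.
Proof. by rewrite /computable1 /int_end; comp_auto. Qed.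
#[local] Hint Resolve comp_int_end : computable.

Lemma comp_cell_next : computable1 cell_next.
Proof. by rewrite /computable1 /cell_next; comp_auto. Qed.
#[local] Hint Resolve comp_cell_next : computable.

Lemma comp_nat_lt : computable2 (fun w p q => nat_lt w p q : nat).
Proof. by rewrite /computable2 /nat_lt; comp_auto. Qed.
#[local] Hint Resolve comp_nat_lt : computable.

Lemma comp_cells_end : computable1 cells_end.
Proof. by rewrite /computable1 /cells_end; comp_auto. Qed.
#[local] Hint Resolve comp_cells_end : computable.

Lemma comp_cell_elt : computable2 cell_elt.
Proof. by rewrite /computable2 /cell_elt; comp_auto. Qed.
#[local] Hint Resolve comp_cell_elt : computable.

Lemma comp_int_lt : computable2 (fun w p q => int_lt w p q : nat).
Proof. by rewrite /computable2 /int_lt; comp_auto. Qed.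
#[local] Hint Resolve comp_int_lt : computable.

Lemma comp_cell_lt : computable2 (fun w p q => cell_lt w p q : nat).
Proof. by rewrite /computable2 /cell_lt; comp_auto. Qed.
#[local] Hint Resolve comp_cell_lt : computable.

Lemma comp_piece_next : computable1 piece_next.
Proof. by rewrite /computable1 /piece_next; comp_auto. Qed.
#[local] Hint Resolve comp_piece_next : computable.

Lemma comp_pieces_at : computable0 pieces_at.
Proof. by rewrite /computable0 /pieces_at; comp_auto. Qed.
#[local] Hint Resolve comp_pieces_at : computable.

Lemma comp_piece_elt : computable1 piece_elt.
Proof. by rewrite /computable1 /piece_elt; comp_auto. Qed.
#[local] Hint Resolve comp_piece_elt : computable.

Lemma comp_target_at : computable0 target_at.
Proof. by rewrite /computable0 /target_at; comp_auto. Qed.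
#[local] Hint Resolve comp_target_at : computable.

Lemma comp_parity : computable1 (fun w p => parity w p : nat).
Proof. by rewrite /computable1 /parity; comp_auto. Qed.
#[local] Hint Resolve comp_parity : computable.

Lemma comp_goal_at : computable0 goal_at.
Proof. by rewrite /computable0 /goal_at; comp_auto. Qed.
#[local] Hint Resolve comp_goal_at : computable.

Lemma comp_halve : computable1 halve.
Proof. by rewrite /computable1 /halve; comp_auto. Qed.
#[local] Hint Resolve comp_halve : computable.

Lemma comp_cells_len : computable1 cells_len.
Proof. by rewrite /computable1 /cells_len; comp_auto. Qed.
#[local] Hint Resolve comp_cells_len : computable.

Lemma comp_is_target : computable1 (fun w p => is_target w p : nat).
Proof. by rewrite /computable1 /is_target; comp_auto. Qed.
#[local] Hint Resolve comp_is_target : computable.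

Lemma comp_frame_len : computable0 frame_len.
Proof. by rewrite /computable0 /frame_len; comp_auto. Qed.
#[local] Hint Resolve comp_frame_len : computable.

Lemma comp_piece_len : computable1 piece_len.
Proof. by rewrite /computable1 /piece_len; comp_auto. Qed.
#[local] Hint Resolve comp_piece_len : computable.

Lemma comp_list_pos : computable1 list_pos.
Proof. by rewrite /computable1 /list_pos; comp_auto. Qed.
#[local] Hint Resolve comp_list_pos : computable.

Lemma comp_total_len : computable0 total_len.
Proof. by rewrite /computable0 /total_len; comp_auto => w x i; exact: piece_len_leq. Qed.
#[local] Hint Resolve comp_total_len : computable.

Lemma comp_piece_pos : computable1 piece_pos.
Proof. by rewrite /computable1 /piece_pos; comp_auto. Qed.
#[local] Hint Resolve comp_piece_pos : computable.

Lemma comp_is_big : computable1 (fun w p => is_big w p : nat).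
Proof. by rewrite /computable1 /is_big; comp_auto => w x; exact: piece_len_leq. Qed.
#[local] Hint Resolve comp_is_big : computable.

Lemma comp_left_len : computable1 left_len.
Proof. by rewrite /computable1 /left_len; comp_auto => w x i; case: ifP => // _; exact: piece_len_leq. Qed.
#[local] Hint Resolve comp_left_len : computable.

Lemma comp_right_len : computable1 right_len.
Proof. by rewrite /computable1 /right_len; comp_auto => w x i; case: ifP => // _; exact: piece_len_leq. Qed.
#[local] Hint Resolve comp_right_len : computable.

Lemma comp_good_cut : computable1 (fun w p => good_cut w p : nat).
Proof. by rewrite /computable1 /good_cut; comp_auto => w x; [exact: list_pos_leq | exact: cells_len_leq]. Qed.
#[local] Hint Resolve comp_good_cut : computable.

Lemma comp_solve : computable0 (fun w => solve w : nat).
Proof. by apply: (compb_has (p := fun w _ => good_cut w)); comp_auto. Qed.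

(** * Intervals on a line *)

(** Double counting of pairs of an interval and a cell in it: after exchanging the sums, each cell
    contributes at most 1. *)
Lemma sum_disjoint_intervals p (P : pred nat) (s l : nat -> nat) u v :
  (forall i, i < p -> P i -> u <= s i /\ s i + l i <= v) ->
  (forall i j, i < p -> j < p -> P i -> P j -> i != j ->
     s i + l i <= s j \/ s j + l j <= s i) ->
  \sum_(0 <= i < p | P i) l i <= v - u.
Proof.
move=> bnd dis.
have len i : i < p -> P i -> l i = \sum_(u <= x < v) (s i <= x < s i + l i).
  move=> ip Pi; have [us sv] := bnd i ip Pi.
  rewrite (big_cat_nat (n := s i)) //=; last by lia.
  rewrite (big_cat_nat (m := s i) (n := s i + l i)) //=; last by lia.
  rewrite [X in X + _]big_nat_cond [X in X + _]big1 ?add0n; last by move=> x; lia.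
  rewrite [X in _ + X]big_nat_cond [X in _ + X]big1 ?addn0; last by move=> x; lia.
  rewrite (eq_big_nat _ _ (F2 := fun=> 1)); last by move=> x ->.
  by rewrite sum_nat_const_nat muln1; lia.
rewrite big_nat_cond (eq_bigr (fun i => \sum_(u <= x < v) (s i <= x < s i + l i))); last first.
  by move=> i /andP[/andP[_ ip] Pi]; apply: len.
rewrite exchange_big /= -[v - u]muln1 -sum_nat_const_nat; apply: leq_sum => x _.
rewrite -big_nat_cond.
have [/hasP[i iI /andP[Pi ix]]|none] := boolP (has (fun i => P i && (s i <= x < s i + l i)) (index_iota 0 p)).
  rewrite mem_index_iota /= in iI.
  rewrite big_mkcond (bigD1_seq i) ?mem_index_iota ?iota_uniq //= Pi ix big_nat_cond big1 //.
  move=> j /andP[/andP[_ jp] ji]; case: ifP => // Pj.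
  by case: (dis i j) => //; rewrite 1?eq_sym //; lia.
rewrite big_nat_cond big1 // => j /andP[/andP[_ jp] Pj].
apply/eqP; rewrite eqb0; apply: contra none => jx; apply/hasP; exists j.
  by rewrite mem_index_iota.
by rewrite Pj.
Qed.

Section Line.
(* Pieces 0, ..., m - 1 of lengths [l] on a board of [n] cells. *)
Variables (n m : nat) (l : nat -> nat).
Hypothesis l_gt0 : forall i, i < m -> 0 < l i.
Implicit Types (a b c : nat -> nat) (s t : seq nat).

Definition valid a :=
  (forall i, i < m -> a i + l i <= n) /\
  (forall i j, i < m -> j < m -> i != j -> a i + l i <= a j \/ a j + l j <= a i).

Definition one_move a b :=
  exists i, [/\ i < m, forall j, j < m -> j != i -> b j = a j & valid b].

(** Positions are functions on all of [nat], of which only the values below [m] matter; hence the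
    agreement in [linked_refl]. *)
Inductive linked : (nat -> nat) -> (nat -> nat) -> Prop :=
| linked_refl a b : (forall i, i < m -> b i = a i) -> linked a b
| linked_step a b c : linked a b -> one_move b c -> linked a c.

Definition all_len := \sum_(0 <= i < m) l i.
Definition big i := n < all_len + l i.

Lemma valid_ext a b : (forall i, i < m -> b i = a i) -> valid a -> valid b.
Proof.
move=> e [v1 v2]; split=> [i im|i j im jm ij]; first by rewrite e // v1.
by rewrite !e //; apply: v2.
Qed.

Lemma linked_valid a b : linked a b -> valid a -> valid b.
Proof. by elim=> {a b} [a b e|a b c _ IH [i []] //]; apply: valid_ext. Qed.

Lemma linked_extr a b c : linked a b -> (forall i, i < m -> c i = b i) -> linked a c.
Proof.
move=> L; elim: L c => {a b} [a b e c e'|a b c L IH [i [im f v]] d e].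
  by apply: linked_refl => i im; rewrite e' // e.
apply: linked_step L _; exists i; split=> // [j jm ji|].
  by rewrite e // f.
exact: valid_ext e v.
Qed.

Lemma linked_trans a b c : linked a b -> linked b c -> linked a c.
Proof.
move=> L1 L2; elim: L2 a L1 => {b c} [b c e a L1|b c d _ IH M a L1].
  exact: linked_extr L1 e.
exact: linked_step (IH _ L1) M.
Qed.

Lemma linked_move a b : one_move a b -> linked a b.
Proof. by apply: linked_step; apply: linked_refl. Qed.

Lemma linked_sym a b : valid a -> linked a b -> linked b a.
Proof.
move=> va L; elim: L va => {a b} [a b e _|a b c L IH [i [im f v]] va].
  by apply: linked_refl => i im; rewrite e.
apply: linked_trans (IH va); apply: linked_move; exists i; split=> //.
  by move=> j jm ji; rewrite f.
exact: linked_valid L va.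
Qed.

(* The board then has room for a second copy of piece [i]. *)
Lemma one_move_far a b i : valid a -> valid b -> i < m ->
  (forall j, j < m -> j != i -> b j = a j) ->
  a i + l i <= b i \/ b i + l i <= a i -> ~~ big i.
Proof.
move=> [a1 a2] [b1 b2] im f far; rewrite -leqNgt.
(* The second copy gets index [m] and occupies the old place of piece [i], while [i] itself is at
   its new place. *)
pose s k := if k == m then a i else b k; pose l' k := if k == m then l i else l k.
have := @sum_disjoint_intervals m.+1 xpredT s l' 0 n.
have l'm : l' m = l i by rewrite /l' eqxx.
rewrite subn0 big_nat_recr //= l'm.
rewrite (eq_big_nat _ _ (F2 := l)); last by move=> k /andP[_ km]; rewrite /l' ltn_eqF.
apply=> [k km _|k j km jm _ _ kj]; rewrite /s /l'.
  by split=> //; case: eqP => [_|/eqP ne]; [apply: a1 | apply: b1; lia].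
case: (eqVneq k m) => [km'|ne]; case: (eqVneq j m) => [jm'|ne'].
- by rewrite km' jm' eqxx in kj.
- have jm1 : j < m by lia.
  by case: (eqVneq j i) => [->//|ji]; rewrite f //; apply: a2; rewrite // eq_sym.
- have km1 : k < m by lia.
  by case: (eqVneq k i) => [->|ki]; [rewrite or_comm | rewrite f //; apply: a2].
- by apply: b2; lia.
Qed.

(** If a move of one big piece past another reversed their order, the piece at rest would lie
    between the old and the new place of the moved one. These places would be disjoint, which
    [one_move_far] rules out for a big piece. *)
Lemma linked_order a b i j : valid a -> linked a b -> i < m -> j < m ->
  big i -> big j -> a i < a j -> b i < b j.
Proof.
move=> va L im jm Bi Bj; elim: L va => {a b} [a b e _|a b c L IH [k [km f vc]] va aij].
  by rewrite !e.
have vb := linked_valid L va; have {IH aij} bij := IH va aij.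
have ij : i != j by apply/eqP => E; rewrite E ltnn in bij.
have [_ b2] := vb; have [_ c2] := vc.
have li := l_gt0 im; have lj := l_gt0 jm.
case: (ltnP (c i) (c j)) => // cji.
have bd : b i + l i <= b j by case: (b2 i j im jm ij); lia.
have cd : c j + l j <= c i by case: (c2 i j im jm ij); lia.
case: (eqVneq k i) => [ki|nki].
  subst k; have cj : c j = b j by apply: f; rewrite // eq_sym.
  by have /negP[] : ~~ big i by apply: (one_move_far vb vc im f); lia.
have ci : c i = b i by apply: f; rewrite // eq_sym.
case: (eqVneq k j) => [kj|nkj]; last first.
  have cj : c j = b j by apply: f; rewrite // eq_sym.
  by lia.
by subst k; have /negP[] : ~~ big j by apply: (one_move_far vb vc jm f); lia.
Qed.

Lemma valid_neq a i j : valid a -> i < m -> j < m -> i != j -> a i != a j.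
Proof.
move=> [_ v] im jm ij; have := l_gt0 im; have := l_gt0 jm.
by case: (v i j im jm ij); lia.
Qed.

(* [c] separates the big pieces that go left of the target, to be put at [g],
   from those that go right of it. *)
Definition cut_cond a (T g c : nat) :=
  [/\ big T -> c = a T,
      \sum_(0 <= j < m | big j && (j != T) && (a j < c)) l j <= g &
      \sum_(0 <= j < m | big j && (j != T) && (c <= a j)) l j + l T + g <= n].

Lemma linked_cut a b T : valid a -> linked a b -> T < m ->
  exists2 c, c <= n & cut_cond a T (b T) c.
Proof.
move=> va L Tm; have [b1 b2] := linked_valid L va; have [a1 a2] := va.
(* For a small target the cut lies just after the initial positions of all big pieces that end up to
   its left. Since big pieces keep their order, no other big piece starts before the cut. *)
pose c := if big T then a T else \max_(0 <= j < m | big j && (b j < b T)) (a j).+1.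
have bne j : j < m -> j != T -> b j != b T.
  by move=> jm jT; apply: (valid_neq (linked_valid L va)).
have low j : j < m -> big j -> j != T -> a j < c -> b j < b T.
  move=> jm Bj jT; rewrite /c; case: ifP => BT; first exact: linked_order.
  case: (ltnP (b j) (b T)) => // Tj; rewrite ltnNge => /negP[].
  rewrite big_seq_cond; apply/bigmax_leqP_seq => k kI /and3P[_ Bk kT].
  rewrite mem_index_iota /= in kI; rewrite ltnNge; apply/negP => ajk.
  have kj : k != j by apply: contraTneq kT => ->; rewrite -leqNgt.
  have := valid_neq va kI jm kj; rewrite neq_ltn => /orP[|ak]; first by lia.
  by have := linked_order va L jm kI Bj Bk ak; lia.
have high j : j < m -> big j -> j != T -> c <= a j -> b T < b j.
  move=> jm Bj jT; rewrite /c; case: ifP => BT.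
    move=> aj; apply: (linked_order va L Tm jm BT Bj); rewrite ltn_neqAle aj andbT.
    by apply: (valid_neq va); rewrite // eq_sym.
  move=> /bigmax_leqP_seq /(_ j) cj; rewrite ltnNge leq_eqVlt (negbTE (bne _ _ _)) //=.
  apply/negP => bj; have := cj; rewrite mem_index_iota jm Bj bj => /(_ isT isT).
  by rewrite ltnn.
exists c.
  rewrite /c; case: ifP => _; first by have := a1 _ Tm; lia.
  rewrite big_seq_cond; apply/bigmax_leqP_seq => k kI _.
  by rewrite mem_index_iota /= in kI; have := a1 _ kI; have := l_gt0 kI; lia.
split; first by move=> BT; rewrite /c BT.
- rewrite -[X in _ <= X]subn0; apply: (@sum_disjoint_intervals _ _ b).
    move=> j jm /andP[/andP[Bj jT] ac]; split=> //; have := low j jm Bj jT ac.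
    by have := l_gt0 Tm; case: (b2 j T jm Tm jT); lia.
  by move=> i j im jm _ _; apply: b2.
- have := b1 _ Tm => bT.
  suff : \sum_(0 <= j < m | big j && (j != T) && (c <= a j)) l j <= n - (b T + l T) by lia.
  apply: (@sum_disjoint_intervals _ _ b).
    move=> j jm /andP[/andP[Bj jT] ac]; have := high j jm Bj jT ac; split; last exact: b1.
    by have := l_gt0 jm; case: (b2 j T jm Tm jT); lia.
  by move=> i j im jm _ _; apply: b2.
Qed.

(** * Packings listed from left to right, and the rearrangement of small pieces *)

Definition ordered a s :=
  pairwise (fun x y => a x + l x <= a y) s && all (fun x => a x + l x <= n) s.

Definition sum_len s := \sum_(x <- s) l x.

Lemma sum_len_cat s t : sum_len (s ++ t) = sum_len s + sum_len t.
Proof. exact: big_cat. Qed.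

Lemma sum_len_cons x s : sum_len (x :: s) = l x + sum_len s.
Proof. exact: big_cons. Qed.

Lemma sum_len_perm s t : perm_eq s t -> sum_len s = sum_len t.
Proof. exact: perm_big. Qed.

Lemma sum_len_all s : perm_eq s (iota 0 m) -> sum_len s = all_len.
Proof. by move=> /sum_len_perm ->; rewrite /all_len /index_iota subn0. Qed.

Lemma perm_mem_lt s x : perm_eq s (iota 0 m) -> (x \in s) = (x < m).
Proof. by move=> /perm_mem ->; rewrite mem_iota. Qed.

Lemma perm_uniq_iota s : perm_eq s (iota 0 m) -> uniq s.
Proof. by move=> /perm_uniq ->; apply: iota_uniq. Qed.

Lemma pairwise_disjoint a s i j : pairwise (fun x y => a x + l x <= a y) s ->
  i \in s -> j \in s -> i != j -> a i + l i <= a j \/ a j + l j <= a i.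
Proof.
elim: s => //= x s IH /andP[/allP xs ps]; rewrite !inE.
case: (eqVneq i x) => [->|ix] /=; case: (eqVneq j x) => [->|jx] //= iS jS ij.
- by left; apply: xs.
- by right; apply: xs.
- exact: IH.
Qed.

Lemma ordered_valid a s : perm_eq s (iota 0 m) -> ordered a s -> valid a.
Proof.
move=> ps /andP[pw /allP bs]; split=> [i im|i j im jm ij].
  by apply: bs; rewrite (perm_mem_lt _ ps).
by apply: pairwise_disjoint pw _ _ ij; rewrite (perm_mem_lt _ ps).
Qed.

Lemma valid_ordered a : valid a -> exists2 s, perm_eq s (iota 0 m) & ordered a s.
Proof.
move=> va; have [v1 v2] := va; pose s := sort (fun x y => a x <= a y) (iota 0 m).
have ps : perm_eq s (iota 0 m) by rewrite perm_sort.
exists s => //; apply/andP; split; last first.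
  by apply/allP => x; rewrite (perm_mem_lt _ ps) => /v1.
have : pairwise (fun x y => a x <= a y) s.
  rewrite -sorted_pairwise; last by move=> x y z; apply: leq_trans.
  by apply: sort_sorted => x y; apply: leq_total.
move=> pw; have us := perm_uniq_iota ps.
have : pairwise [rel x y | (x != y) && (a x <= a y)] s.
  by rewrite pairwise_relI -uniq_pairwise us.
apply: (@sub_in_pairwise _ (fun x => x < m)); last first.
  by apply/allP => x; rewrite (perm_mem_lt _ ps).
move=> x y xm ym /= /andP[xy axy]; have := l_gt0 ym.
by case: (v2 x y xm ym xy); lia.
Qed.

Fixpoint pack u s y :=
  if s is x :: s' then if y == x then u else pack (u + l x) s' y else u.

Lemma pack_bounds u s y : y \in s -> u <= pack u s y /\ pack u s y + l y <= u + sum_len s.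
Proof.
elim: s u => //= x s IH u; rewrite inE sum_len_cons; case: eqP => [-> _|_ /= ys].
  by split=> //; lia.
by have [] := IH (u + l x) ys; lia.
Qed.

Lemma pairwise_pack u s : uniq s ->
  pairwise (fun x y => pack u s x + l x <= pack u s y) s.
Proof.
elim: s u => //= x s IH u /andP[xs us]; rewrite eqxx; apply/andP; split.
  apply/allP => y ys; case: eqP => [yx|_]; first by rewrite -yx ys in xs.
  by have [] := pack_bounds (u + l x) ys.
rewrite (@eq_in_pairwise _ (mem s) _ (fun y z =>
  pack (u + l x) s y + l y <= pack (u + l x) s z)) ?allss //; first exact: IH.
move=> y z ys zs; case: eqP => [yx|_]; first by rewrite -yx [_ \in s]ys in xs.
by case: eqP => [zx|_]; first by rewrite -zx [_ \in s]zs in xs.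
Qed.

Lemma pack_le a u s y : pairwise (fun x y => a x + l x <= a y) s ->
  (forall x, x \in s -> u <= a x) -> y \in s -> pack u s y <= a y.
Proof.
elim: s u => //= x s IH u /andP[/allP xs ps] ua; rewrite inE.
case: eqP => [->|_] /= ys; first by rewrite ua ?mem_head.
apply: IH => // z zs; have := xs z zs.
by have := ua x (mem_head _ _); lia.
Qed.

(** The second block may start at any free [v]: with the target first in [t], this puts the target
    exactly at [v]. *)
Lemma ordered_two_packs u v s t : uniq (s ++ t) -> u + sum_len s <= v ->
  v + sum_len t <= n ->
  ordered (fun y => if y \in s then pack u s y else pack v t y) (s ++ t).
Proof.
rewrite cat_uniq => /and3P[us /hasPn st ut] uv vn.
have tE y : y \in t -> (y \in s) = false by move=> /st /negbTE.
apply/andP; split; last first.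
  rewrite all_cat; apply/andP; split; apply/allP => y yS.
    by rewrite yS; have [_] := pack_bounds u yS; lia.
  by rewrite tE //; have [_] := pack_bounds v yS; lia.
rewrite pairwise_cat; apply/and3P; split.
- apply/allrelP => x y xs yt; rewrite xs tE //.
  by have [_] := pack_bounds u xs; have [] := pack_bounds v yt; lia.
- rewrite (@eq_in_pairwise _ (mem s) _ (fun x y => pack u s x + l x <= pack u s y)) ?allss //.
    exact: pairwise_pack.
  by move=> x y xs ys; rewrite [x \in s]xs [y \in s]ys.
- rewrite (@eq_in_pairwise _ (mem t) _ (fun x y => pack v t x + l x <= pack v t y)) ?allss //.
    exact: pairwise_pack.
  by move=> x y xs ys; rewrite !tE.
Qed.

Lemma ordered_pack s : perm_eq s (iota 0 m) -> all_len <= n -> ordered (pack 0 s) s.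
Proof.
move=> ps tn; have := @ordered_two_packs 0 0 [::] s; apply=> //=.
- exact: perm_uniq_iota.
- by rewrite /sum_len big_nil.
- by rewrite (sum_len_all ps).
Qed.

Lemma ordered_total a s : perm_eq s (iota 0 m) -> ordered a s -> all_len <= n.
Proof.
move=> ps oa; have [v1 v2] := ordered_valid ps oa.
rewrite -[n]subn0 /all_len; apply: (@sum_disjoint_intervals m xpredT a) => [i im _|i j im jm _ _].
  by split=> //; apply: v1.
exact: v2.
Qed.

(** A moved piece ends by [b y], and [b y <= a y] for every [y] still waiting, so shifting to the
    left never causes a collision. *)
Lemma ordered_mix a b s1 s2 : uniq (s1 ++ s2) -> ordered a (s1 ++ s2) ->
  ordered b (s1 ++ s2) -> {in s2, forall x, b x <= a x} ->
  ordered (fun x => if x \in s1 then b x else a x) (s1 ++ s2).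
Proof.
rewrite cat_uniq => /and3P[_ /hasPn st _] /andP[] pa ba /andP[] pb bb le_ba.
have s2E y : y \in s2 -> (y \in s1) = false by move=> /st /negbTE.
move: pa ba pb bb; rewrite /ordered !all_cat !pairwise_cat.
move=> /and3P[_ _ pa] /andP[_ ba] /and3P[/allrelP rb pb _] /andP[bb _].
apply/andP; split; last first.
  apply/andP; split; apply/allP => y yS; first by rewrite yS (allP bb).
  by rewrite s2E ?(allP ba).
apply/and3P; split.
- apply/allrelP => x y xs ys; rewrite xs s2E //.
  exact: leq_trans (rb x y xs ys) (le_ba y ys).
- rewrite (@eq_in_pairwise _ (mem s1) _ (fun x y => b x + l x <= b y)) ?allss //.
  by move=> x y xs ys; rewrite [x \in s1]xs [y \in s1]ys.
- rewrite (@eq_in_pairwise _ (mem s2) _ (fun x y => a x + l x <= a y)) ?allss //.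
  by move=> x y xs ys; rewrite !s2E.
Qed.

(* The pieces are moved to their new places one by one, in the order [s]. *)
Lemma linked_shrink a b s : perm_eq s (iota 0 m) -> ordered a s -> ordered b s ->
  {in s, forall x, b x <= a x} -> linked a b.
Proof.
move=> ps oa ob le_ba.
pose mix k x := if x \in take k s then b x else a x.
have vmix k : valid (mix k).
  apply: (ordered_valid ps); rewrite /mix -{2}(cat_take_drop k s).
  apply: ordered_mix; rewrite ?cat_take_drop //; first exact: perm_uniq_iota.
  by move=> x /mem_drop; apply: le_ba.
suff mixed k : k <= size s -> linked a (mix k).
  apply: linked_extr (mixed _ (leqnn _)) _ => i im.
  by rewrite /mix take_size (perm_mem_lt _ ps) im.
elim: k => [_|k IH ks]; first by apply: linked_refl => i _; rewrite /mix take0.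
apply: linked_step (IH (ltnW ks)) _; exists (nth 0 s k); split=> //.
  by rewrite -(perm_mem_lt _ ps) mem_nth.
by move=> j jm jk; rewrite /mix (take_nth 0 ks) mem_rcons inE (negbTE jk).
Qed.

(** Both packings can be pushed to the left end, which gives the same packing, and moves are
    reversible. *)
Lemma linked_ordered a b s : perm_eq s (iota 0 m) -> ordered a s -> ordered b s ->
  linked a b.
Proof.
move=> ps.
have packed c : ordered c s -> linked c (pack 0 s).
  move=> oc; apply: (linked_shrink ps oc (ordered_pack ps (ordered_total ps oc))).
  by move=> x xs; apply: pack_le => //; case/andP: oc.
move=> oa ob; apply: linked_trans (packed _ oa) _.
by apply: linked_sym (packed _ ob); apply: ordered_valid ob.
Qed.

(** Once everything is pushed to the left, the cells from [all_len] on are free, and [~~ big x] says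
    that [x] fits there. *)
Lemma linked_last a b s t x : perm_eq (s ++ x :: t) (iota 0 m) -> ~~ big x ->
  ordered a (s ++ x :: t) -> ordered b (s ++ rcons t x) -> linked a b.
Proof.
move=> ps small oa ob; have tn := ordered_total ps oa.
have op := ordered_pack ps tn; have vp := ordered_valid ps op.
have ps' : perm_eq (s ++ rcons t x) (iota 0 m).
  by apply: (perm_trans _ ps); rewrite perm_cat2l perm_rcons.
have /andP[xst _] : uniq (x :: s ++ t).
  by rewrite -(perm_uniq (permEl (perm_catCA s [:: x] t))) (perm_uniq_iota ps).
set p := pack 0 (s ++ x :: t) in op vp.
have stE y : y \in s ++ t -> y \in s ++ x :: t.
  by rewrite !mem_cat inE => /orP[|] ->; rewrite ?orbT.
pose c y := if y == x then all_len else p y.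
have cE y : y \in s ++ t -> c y = p y.
  by rewrite /c; case: eqP => // ->; rewrite (negbTE xst).
have oc : ordered c (s ++ rcons t x).
  case/andP: op => pp bp; rewrite /ordered -rcons_cat all_rcons pairwise_rcons.
  have cx : c x = all_len by rewrite /c eqxx.
  apply/and3P; split; [apply/andP; split | | ].
  - apply/allP => y yst; rewrite cx cE // -(sum_len_all ps).
    by have [] := pack_bounds 0 (stE y yst).
  - rewrite (@eq_in_pairwise _ (mem (s ++ t)) _ (fun y z => p y + l y <= p z)) ?allss //.
      apply: subseq_pairwise pp; apply: cat_subseq => //; exact: subseq_cons.
    by move=> y z ys zs; rewrite !cE.
  - by rewrite cx leqNgt.
  - by apply/allP => y yst; rewrite cE //; apply: (allP bp); apply: stE.
apply: linked_trans (linked_ordered ps oa op) _.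
apply: linked_trans (linked_ordered ps' oc ob); apply: linked_move.
exists x; split; last exact: ordered_valid ps' oc.
  by rewrite -(perm_mem_lt _ ps) mem_cat mem_head orbT.
by move=> j _ jx; rewrite /c (negbTE jx).
Qed.

(** A canonical packing that depends on [s] only through the order of its big pieces: the small ones
    are sent to the right end one at a time. *)
Lemma linked_bigs a s : perm_eq s (iota 0 m) -> ordered a s ->
  linked a (pack 0 (filter big s ++ filter (predC big) (iota 0 m))).
Proof.
move=> ps oa; have tn := ordered_total ps oa; have us := perm_uniq_iota ps.
(* [xs] lists the small pieces already sent to the end, in order of arrival. *)
have moved xs : uniq xs -> all (fun x => (x < m) && ~~ big x) xs ->
    linked a (pack 0 (filter (predC (mem xs)) s ++ xs)).
  elim/last_ind: xs => [_ _|xs x IH].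
    rewrite cats0 (eq_filter (a2 := predT)) // filter_predT.
    exact: linked_ordered ps oa (ordered_pack ps tn).
  rewrite rcons_uniq all_rcons => /andP[xxs uxs] /andP[/andP[xm sx] small].
  apply: linked_trans (IH uxs small) _.
  have perm_moved ys : uniq ys -> all (fun x => (x < m) && ~~ big x) ys ->
      perm_eq (filter (predC (mem ys)) s ++ ys) (iota 0 m).
    move=> uys /allP ym; apply: (perm_trans _ ps); apply: uniq_perm => //.
      rewrite cat_uniq filter_uniq // uys andbT; apply/hasPn => y yys.
      by rewrite mem_filter /= yys.
    move=> y; rewrite mem_cat mem_filter /=; case: (boolP (y \in ys)) => [yys|_].
      by rewrite (perm_mem_lt _ ps); have /andP[->] := ym y yys.
    by rewrite orbF.
  have p1 := perm_moved _ uxs small.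
  have p2 : perm_eq (filter (predC (mem (rcons xs x))) s ++ rcons xs x) (iota 0 m).
    by apply: perm_moved; rewrite ?rcons_uniq ?xxs // all_rcons xm sx.
  have : filter (predC (mem (rcons xs x))) s = filter (predC1 x) (filter (predC (mem xs)) s).
    rewrite -filter_predI; apply: eq_filter => y /=.
    by rewrite mem_rcons inE negb_or.
  have uF : uniq (filter (predC (mem xs)) s) by rewrite filter_uniq.
  have xF : x \in filter (predC (mem xs)) s by rewrite mem_filter /= xxs (perm_mem_lt _ ps).
  move: p1 p2 uF; case/splitPr: xF => s1 s2 p1 p2 uF FE.
  have F12 : filter (predC1 x) (s1 ++ x :: s2) = s1 ++ s2.
    rewrite filter_cat /= eqxx /=; move: uF.
    rewrite -(perm_uniq (permEl (perm_catCA [:: x] s1 s2))) /= mem_cat negb_or.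
    case/andP=> /andP[x1 x2] _.
    by congr cat; apply/all_filterP/allP => y ys; apply: contraTneq ys => ->.
  have e1 : (s1 ++ x :: s2) ++ xs = s1 ++ x :: (s2 ++ xs) by rewrite -catA.
  have e2 : (s1 ++ s2) ++ rcons xs x = s1 ++ rcons (s2 ++ xs) x by rewrite rcons_cat catA.
  rewrite FE F12 e2 in p2 *; rewrite e1 in p1 *.
  by apply: (linked_last p1 sx); apply: ordered_pack.
have -> : filter big s = filter (predC (mem (filter (predC big) (iota 0 m)))) s.
  apply: eq_in_filter => x; rewrite (perm_mem_lt _ ps) => xm /=.
  by rewrite mem_filter mem_iota /= add0n xm andbT negbK.
apply: moved; first by rewrite filter_uniq ?iota_uniq.
by apply/allP => x; rewrite mem_filter mem_iota /= => /andP[-> ->].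
Qed.

(** A discrete intermediate value argument: the partial sums start at most at [g], end at least at
    [g - e], and grow by at most [e] at a time. *)
Lemma greedy s u e g : all (fun x => l x <= e) s -> u <= g -> g <= u + sum_len s + e ->
  exists k, u + sum_len (take k s) <= g <= u + sum_len (take k s) + e.
Proof.
elim: s u => [|x s IH] u /= se ug gs; first by exists 0; rewrite /sum_len /= big_nil in gs *; lia.
case/andP: se => xe se; case: (leqP g (u + e)) => ge.
  by exists 0; rewrite take0 /sum_len big_nil; lia.
have [||k] := IH (u + l x) se; rewrite ?sum_len_cons in gs *; try lia.
by exists k.+1; rewrite /= sum_len_cons; lia.
Qed.

Theorem cut_linked a (T g c : nat) : valid a -> T < m -> cut_cond a T g c ->
  exists2 b, linked a b & b T = g.
Proof.
move=> va Tm [cT cL cR]; have [s ps os] := valid_ordered va.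
have us := perm_uniq_iota ps; have tn := ordered_total ps os.
pose BL := [seq x <- s | big x && (x != T) && (a x < c)].
pose BR := [seq x <- s | big x && (x != T) && (c <= a x)].
pose S := [seq x <- s | ~~ big x && (x != T)].
have sumE (P : pred nat) : \sum_(0 <= j < m | P j) l j = sum_len (filter P s).
  by rewrite /sum_len big_filter (perm_big _ ps) /index_iota subn0.
rewrite !sumE -/BL -/BR in cL cR.
(* [F] is arbitrary because this is used twice: for the lengths, and for the counts that show
   [L ++ R] to be a permutation of [s]. *)
have splitE (F : nat -> nat) : \sum_(x <- s) F x =
    \sum_(x <- BL) F x + \sum_(x <- S) F x + F T + \sum_(x <- BR) F x.
  rewrite /BL /BR /S !big_filter.
  rewrite (bigD1_seq T) ?(perm_mem_lt _ ps) //= (bigID big) /=.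
  rewrite (bigID (fun x => a x < c) (fun x => (x != T) && big x)) /=.
  rewrite (eq_bigl (fun x => big x && (x != T) && (a x < c))); last by move=> x; rewrite [_ && big x]andbC.
  rewrite [X in _ + (_ + X + _)](eq_bigl (fun x => big x && (x != T) && (c <= a x))); last first.
    by move=> x; rewrite -leqNgt [_ && big x]andbC.
  rewrite [X in _ + (_ + X)](eq_bigl (fun x => ~~ big x && (x != T))); last by move=> x; rewrite andbC.
  lia.
have totalE : all_len = sum_len BL + sum_len S + l T + sum_len BR.
  by rewrite -(sum_len_all ps) /sum_len splitE.
(* The upper bound on [g] required here is [cL] mirrored: [cR] bounds [g] by [n - l T - sum_len BR],
   which equals [sum_len BL + sum_len S + (n - all_len)]. *)
have [|||k /andP[k1 k2]] := @greedy S (sum_len BL) (n - all_len) g; try lia.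
  apply/allP => x; rewrite mem_filter => /andP[/andP[xs _] _].
  by rewrite /big in xs; lia.
(* [L] is packed at the left end and [R] from [g] on; [k1] makes [L] fit before [g], and [k2] makes
   [R] fit before [n]. *)
pose L := BL ++ take k S; pose R := T :: (drop k S ++ BR).
have tE : perm_eq (L ++ R) s.
  apply/permP => Q; have count_sum r : count Q r = \sum_(x <- r) (Q x : nat).
    by rewrite -sum1_count big_mkcond.
  rewrite (count_sum s) splitE -!count_sum !count_cat /= count_cat.
  by rewrite -{3}(cat_take_drop k S) count_cat; lia.
have ut : uniq (L ++ R) by rewrite (perm_uniq tE).
have pt : perm_eq (L ++ R) (iota 0 m) by apply: (perm_trans _ ps).
have := cat_take_drop k S => /(congr1 sum_len); rewrite sum_len_cat => SE.
have ob := @ordered_two_packs 0 g L R ut; rewrite sum_len_cons !sum_len_cat in ob.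
have {}ob := ob k1 _; have {ob} ob := ob ltac:(lia).
set b := (fun y : nat => _) in ob.
have TL : T \notin L 
  by move: ut; rewrite (perm_uniq (permEl (perm_catCA L [:: T] _))) /= mem_cat negb_or => /andP[/andP[]].
exists b; last by rewrite /b (negbTE TL) /= eqxx.
apply: linked_trans (linked_bigs ps os) _.
have pw : pairwise (fun x y => a x < a y) s.
  case/andP: os => pw _; apply: (@sub_in_pairwise _ (mem s)) pw; rewrite ?allss //.
  by move=> x y xs _ /=; have := l_gt0 (i := x); rewrite -(perm_mem_lt _ ps) => /(_ xs); lia.
pose o := if big T then [:: T] else [::].
have bigE : filter big (L ++ R) = BL ++ o ++ BR.
  have small r : {subset r <= S} -> filter big r = [::].
    move=> rS; apply/eqP; rewrite -(negbK (_ == _)) -has_filter; apply/hasPn => x /rS.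
    by rewrite mem_filter => /andP[/andP[]].
  rewrite !filter_cat /= filter_cat (small (take k S)) ?(small (drop k S)); last first.
  - by move=> x /mem_take.
  - by move=> x /mem_drop.
  rewrite cats0 /= /o; have -> : filter big BL = BL.
    by apply/all_filterP/allP => x; rewrite mem_filter => /andP[/andP[/andP[]]].
  have -> : filter big BR = BR.
    by apply/all_filterP/allP => x; rewrite mem_filter => /andP[/andP[/andP[]]].
  by case: ifP.
(* Both lists have the same elements and increase strictly in the initial position [a], so they
   coincide. A big target belongs between [BL] and [BR] because the cut is then its own position. *)
have -> : filter big s = filter big (L ++ R).
  apply: (@irr_sorted_eq _ (fun x y => a x < a y)).
  - by move=> x y z; apply: ltn_trans.
  - by move=> x; rewrite ltnn.
  - by apply: pairwise_sorted; apply: pairwise_filter.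
  - rewrite bigE; apply: pairwise_sorted; rewrite !pairwise_cat.
    rewrite !(pairwise_filter _ pw) andbT /=; apply/and3P; split.
    + apply/allrelP => x y; rewrite mem_filter => /andP[/andP[_ xc] _].
      rewrite mem_cat => /orP[|]; last by rewrite mem_filter => /andP[/andP[_ yc] _]; lia.
      by rewrite /o; case: ifP => // /cT cE; rewrite inE => /eqP ->; rewrite -cE.
    + apply/allrelP => x y; rewrite /o; case: ifP => // /cT cT'; rewrite inE => /eqP ->.
      rewrite mem_filter => /andP[/andP[/andP[_ yT] cy]]; rewrite (perm_mem_lt _ ps) => ym.
      rewrite ltn_neqAle -cT' cy andbT cT'.
      by apply: (valid_neq va); rewrite // eq_sym.
    + by rewrite /o; case: ifP.
  - by move=> x; rewrite !mem_filter (perm_mem tE).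
apply: linked_sym (linked_bigs pt ob); exact: ordered_valid ob.
Qed.

End Line.

(** * Running the procedure on an encoded instance *)

Lemma iter_half0 k : iter k half 0 = 0.
Proof. by elim: k => //= k ->. Qed.

Lemma nth_nbits_aux f n k : n <= f ->
  nth false (nbits_aux f n) k = odd (iter k half n).
Proof.
elim: f n k => [|f IH] [|n] k nf; rewrite ?iter_half0 ?nth_nil //.
case: k => // k; rewrite iterSr -IH //.
by rewrite -ltnS (leq_trans _ nf) // ltnS leq_uphalf_double -addnn leq_addr.
Qed.

Lemma iter_half_leq k n : iter k half n <= n - k.
Proof. by elim: k => [|k IH] /=; [rewrite subn0 | lia]. Qed.

Lemma iter_half_nbits f n : n <= f -> iter (size (nbits_aux f n)) half n = 0.
Proof.
elim: f n => [|f IH] [|n] //= nf; rewrite -iterS iterSr IH //=.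
by rewrite leq_uphalf_double; lia.
Qed.

(* Bits come least significant first, so the last difference decides. *)
Lemma compare_bits N a b s : iter N half a = 0 -> iter N half b = 0 ->
  foldl (fun acc k => if odd (iter k half a) == odd (iter k half b) then acc
                      else odd (iter k half b)) s (iota 0 N) =
  if a == b then s else a < b.
Proof.
elim: N a b s => [|N IH] a b s; first by move=> /= -> ->.
rewrite !iterSr => a0 b0; rewrite /= (iotaDl 1 0).
have shift r l : foldl (fun acc k => if odd (iter k half a) == odd (iter k half b)
      then acc else odd (iter k half b)) r [seq 1 + k | k <- l] =
    foldl (fun acc k => if odd (iter k half a./2) == odd (iter k half b./2)
      then acc else odd (iter k half b./2)) r l.
  by elim: l r => //= k l IHl r; rewrite IHl -!iterS !iterSr.
rewrite shift IH //; have := odd_double_half a; have := odd_double_half b.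
rewrite -!muln2; case: (a./2 =P b./2) => h; case: (a =P b) => h';
  by case: (odd a); case: (odd b) => //=; lia.
Qed.

Lemma eq_bits N a b : iter N half a = 0 -> iter N half b = 0 ->
  (forall k, k < N -> odd (iter k half a) = odd (iter k half b)) -> a = b.
Proof.
elim: N a b => [|N IH] a b; first by move=> /= -> ->.
rewrite !iterSr => a0 b0 e; rewrite -(odd_double_half a) -(odd_double_half b).
rewrite (e 0) // (IH a./2 b./2) // => k kN.
by have := e k.+1 kN; rewrite !iterSr.
Qed.

Lemma filter_upto N n : n <= N -> [seq i <- iota 0 N | i < n] = iota 0 n.
Proof. by move=> nN; rewrite -[RHS](filter_iota_ltn 0 nN). Qed.

Lemma count_upto N n (P : pred nat) : n <= N ->
  count (fun i => (i < n) && P i) (iota 0 N) = count P (iota 0 n).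
Proof.
move=> nN; rewrite -(filter_upto nN) count_filter.
by apply: eq_count => i /=; rewrite andbC.
Qed.

Lemma all_upto N n (P : pred nat) : n <= N ->
  all (fun i => (i < n) ==> P i) (iota 0 N) = all P (iota 0 n).
Proof. by move=> nN; rewrite -(filter_upto nN) all_filter. Qed.

(** * Reading the encoded word *)

Section Reads.
Variable w : seq bool.
Local Notation N := (size w).
Local Notation bit := (nth false w).

Definition reads p s := exists t, drop p w = s ++ t.

Lemma reads_cat p s t : reads p (s ++ t) -> reads p s /\ reads (p + size s) t.
Proof.
move=> [r E]; split; first by exists (t ++ r); rewrite catA.
by exists r; rewrite addnC -drop_drop E -catA drop_size_cat.
Qed.

Lemma reads_cons p b s : reads p (b :: s) -> bit p = b /\ reads p.+1 s.
Proof.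
move=> H; have [_] := reads_cat (s := [:: b]) H; rewrite addn1 => ?; split=> //.
by have [r E] := H; rewrite -[p]addn0 -nth_drop E.
Qed.

Lemma reads_size p s : reads p s -> size s <= N.
Proof.
by move=> [r /(congr1 size)]; rewrite size_drop size_cat; lia.
Qed.

Section Lists.
Variables (A : Type) (x0 : A) (e : A -> seq bool) (next : nat -> nat).
Hypothesis next_elt : forall p x, reads p (true :: e x) -> next p = p + (size (e x)).+1.
Hypothesis next_end : forall p, bit p = false -> next p = p.

Lemma enc_seq_cons x xs : enc_seq e (x :: xs) = (true :: e x) ++ enc_seq e xs.
Proof. by rewrite /enc_seq /= -catA. Qed.

(** Each element brings its own [true] and the list a closing [false]; so every list in the word has
    fewer than [N] elements, and capping iterations at [N] loses nothing. *)
Lemma size_enc_seq xs : size xs < size (enc_seq e xs).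
Proof.
elim: xs => // x xs IH; rewrite enc_seq_cons size_cat addSn ltnS.
exact: leq_trans IH (leq_addl _ _).
Qed.

Lemma list_elt p xs k : reads p (enc_seq e xs) -> k < size xs ->
  reads (iter k next p) (true :: e (nth x0 xs k)).
Proof.
elim: xs p k => // x xs IH p k; rewrite enc_seq_cons => /reads_cat[r1 r2] kx.
case: k kx => //= k kx; rewrite -iterS iterSr (next_elt r1).
exact: IH.
Qed.

Lemma list_end p xs k : reads p (enc_seq e xs) -> size xs <= k ->
  (iter k next p).+1 = p + size (enc_seq e xs) /\ bit (iter k next p) = false.
Proof.
elim: xs p k => [|x xs IH] p k; last first.
  rewrite enc_seq_cons size_cat => /reads_cat[r1 r2]; case: k => //= k kx.
  by rewrite -iterS iterSr (next_elt r1) addnA; apply: IH.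
move=> /reads_cons[b0 _] _ /=; rewrite addn1; have -> : iter k next p = p.
  by elim: k => //= k ->; apply: next_end.
by [].
Qed.

Lemma list_elt_min p xs k : reads p (enc_seq e xs) -> k < size xs ->
  reads (iter (minn k N) next p) (true :: e (nth x0 xs k)).
Proof.
move=> H kx; have := reads_size H; have := size_enc_seq xs => ? ?.
by rewrite (minn_idPl _); [apply: list_elt | lia].
Qed.

Lemma list_end_min p xs k : reads p (enc_seq e xs) -> size xs <= k ->
  (iter (minn k N) next p).+1 = p + size (enc_seq e xs) /\
  bit (iter (minn k N) next p) = false.
Proof.
move=> H kx; have := reads_size H; have := size_enc_seq xs => ? ?.
by apply: list_end => //; lia.
Qed.

Lemma list_bit p xs k : reads p (enc_seq e xs) ->
  bit (iter (minn k N) next p) = (k < size xs).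
Proof.
move=> H; case: ltnP => kx; last by case: (list_end_min H kx).
by have /reads_cons[] := list_elt_min H kx.
Qed.

Lemma list_end_full p xs : reads p (enc_seq e xs) ->
  (iter (minn N N) next p).+1 = p + size (enc_seq e xs).
Proof.
move=> H; have := reads_size H; have := size_enc_seq xs => ? ?.
by case: (list_end_min (k := N) H) => //; lia.
Qed.

End Lists.

Definition bits n := nbits_aux n n.

(** A number is a list of one-bit elements followed by one more [false], so the lemmas on lists
    apply to it. *)
Lemma enc_natE n : enc_nat n = enc_seq (fun b => [:: b]) (bits n) ++ [:: false].
Proof. by rewrite /enc_nat /enc_seq -catA. Qed.

Lemma nat_next_elt p (b : bool) : reads p (true :: [:: b]) -> nat_next w p = p + 2.
Proof. by move=> /reads_cons[b1 _]; rewrite /nat_next b1 addn2. Qed.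

Lemma nat_next_end p : bit p = false -> nat_next w p = p.
Proof. by rewrite /nat_next => ->. Qed.

Lemma nat_endE p n : reads p (enc_nat n) -> nat_end w p = p + size (enc_nat n).
Proof.
rewrite enc_natE => /reads_cat[r _]; rewrite size_cat addnA addn1.
by rewrite -(list_end_full nat_next_elt nat_next_end r).
Qed.

Lemma nat_bitE p n k : reads p (enc_nat n) -> nat_bit w p k = odd (iter k half n).
Proof.
rewrite enc_natE => /reads_cat[r _]; rewrite -(@nth_nbits_aux n) // -/(bits n).
rewrite /nat_bit /nat_tag (list_bit false nat_next_elt nat_next_end k r).
case: ltnP => kx; last by rewrite [RHS]nth_default.
by have /reads_cons[_ /reads_cons[]] := list_elt_min false nat_next_elt r kx.
Qed.

Lemma iter_half_reads p n : reads p (enc_nat n) -> iter N half n = 0.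
Proof.
rewrite enc_natE => /reads_cat[r _]; have := reads_size r.
have := size_enc_seq (fun b => [:: b]) (bits n) => ? ?.
rewrite -(subnKC (_ : size (bits n) <= N)); last by lia.
by rewrite addnC iterD iter_half_nbits // iter_half0.
Qed.

Lemma int_endE p z : reads p (enc_int z) -> int_end w p = p + size (enc_int z).
Proof.
by case: z => n /reads_cons[_ r]; rewrite /int_end (nat_endE r); apply: addSnnS.
Qed.

Lemma cell_next_elt p x : reads p (true :: enc_cell x) ->
  cell_next w p = p + (size (enc_cell x)).+1.
Proof.
move=> /reads_cons[b1 /reads_cat[r1 r2]]; rewrite /cell_next b1.
by rewrite (int_endE r1) (int_endE r2) size_cat -addnA addSnnS.
Qed.

Lemma cell_next_end p : bit p = false -> cell_next w p = p.
Proof. by rewrite /cell_next => ->. Qed.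

Lemma cells_endE p cs : reads p (enc_seq enc_cell cs) ->
  cells_end w p = p + size (enc_seq enc_cell cs).
Proof. by move=> r; rewrite /cells_end (list_end_full cell_next_elt cell_next_end r). Qed.

Lemma piece_next_elt p x : reads p (true :: enc_seq enc_cell x) ->
  piece_next w p = p + (size (enc_seq enc_cell x)).+1.
Proof.
by move=> /reads_cons[b1 r]; rewrite /piece_next b1 (cells_endE r) addSnnS.
Qed.

Lemma piece_next_end p : bit p = false -> piece_next w p = p.
Proof. by rewrite /piece_next => ->. Qed.

Lemma nat_ltE p q a b : reads p (enc_nat a) -> reads q (enc_nat b) ->
  nat_lt w p q = (a < b).
Proof.
move=> ra rb; rewrite /nat_lt.
have := @compare_bits N a b false (iter_half_reads ra) (iter_half_reads rb).
have -> : (if a == b then false else a < b) = (a < b).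
  by case: eqP => // ->; rewrite ltnn.
move=> <-; elim: (iota 0 N) false => //= k l IH acc.
by rewrite (nat_bitE k ra) (nat_bitE k rb) IH.
Qed.

Lemma int_ltE p q x y : reads p (enc_int x) -> reads q (enc_int y) ->
  int_lt w p q = (x < y)%R.
Proof.
case: x => a; case: y => b /reads_cons[bp rp] /reads_cons[bq rq];
  rewrite /int_lt bp bq //.
- by rewrite (nat_ltE rp rq).
- by rewrite (nat_ltE rq rp).
Qed.

(* One coordinate is constant on a frame of width 1, so there this is the order
   along the frame. *)
Definition cell_before (f x : cell) := (f.1 < x.1)%R || (f.2 < x.2)%R.

Lemma cell_ltE p q x y : reads p (enc_cell x) -> reads q (enc_cell y) ->
  cell_lt w p q = cell_before x y.
Proof.
move=> /reads_cat[rx rx'] /reads_cat[ry ry'].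
by rewrite /cell_lt (int_ltE rx ry) (int_endE rx) (int_endE ry) (int_ltE rx' ry').
Qed.

Lemma parityE n : n <= N -> parity w n = odd n.
Proof.
move=> nN; rewrite /parity -(subnKC nN) iotaD foldl_cat add0n.
have low k : k <= n -> foldl (fun acc i => if i < n then ~~ acc else acc) false (iota 0 k) = odd k.
  elim: k => [//|k IH] kn; rewrite -{1}addn1 iotaD foldl_cat IH 1?ltnW //= add0n.
  by rewrite kn.
rewrite low //; move: (odd n) (N - n) => b k.
have: all (fun i => n <= i) (iota n k) by apply/allP => i; rewrite mem_iota => /andP[].
by elim: (iota n k) b => //= i s IH b /andP[]; rewrite leqNgt => /negbTE -> /IH.
Qed.

Lemma halveE n : n <= N -> halve w n = n./2.
Proof.
move=> nN; rewrite /halve count_upto // (eq_in_count (a2 := odd)); last first.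
  by move=> k; rewrite mem_iota /= add0n => kn; apply: parityE; lia.
elim: n {nN} => // n IH; rewrite -addn1 iotaD count_cat IH /= add0n addn0 addn1 /=.
by rewrite uphalf_half addnC.
Qed.

Lemma is_targetE p n j : target_at w = p -> reads p (enc_nat n) -> j < N ->
  is_target w j = (j == n).
Proof.
move=> tp r jN; rewrite /is_target tp.
(* [halve] is correct only up to [N], and the iterates never exceed [j]. *)
have hv k : iter k (halve w) j = iter k half j.
  elim: k => //= k ->; apply: halveE; have := iter_half_leq k j; lia.
have bitE k : k < N ->
    (parity w (iter (minn k N) (halve w) j) == nat_bit w p k) =
    (odd (iter k half j) == odd (iter k half n)).
  move=> kN; rewrite (minn_idPl (ltnW kN)) hv (nat_bitE k r) parityE //.
  by have := iter_half_leq k j; lia.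
apply/allP/eqP => [h|jn k]; last by rewrite mem_iota /= add0n => kN; rewrite bitE // jn.
apply: (@eq_bits N); last 1 first.
- by move=> k kN; apply/eqP; rewrite -bitE //; apply: h; rewrite mem_iota.
- by have := iter_half_leq N j; lia.
- exact: iter_half_reads r.
Qed.

Section CellLists.
Variables (p : nat) (cs : seq cell).
Hypothesis r : reads p (enc_seq enc_cell cs).
Local Notation c0 := ((0, 0)%R : cell).

Lemma size_cells : size cs < N.
Proof. by have := reads_size r; have := size_enc_seq enc_cell cs; lia. Qed.

Lemma cell_bitE i : bit (cell_elt w p i) = (i < size cs).
Proof. exact: (list_bit c0 cell_next_elt cell_next_end i r). Qed.

Lemma cell_eltE i : i < size cs -> reads (cell_elt w p i).+1 (enc_cell (nth c0 cs i)).
Proof. by move=> ic; have /reads_cons[] := list_elt_min c0 cell_next_elt r ic. Qed.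

Lemma cells_lenE : cells_len w p = size cs.
Proof.
rewrite /cells_len (eq_count (a2 := fun i => (i < size cs) && true)).
  by rewrite (count_upto xpredT (ltnW size_cells)) count_predT size_iota.
by move=> i; rewrite cell_bitE andbT.
Qed.

End CellLists.

Definition offset (F cs : seq cell) := count (fun f => all (cell_before f) cs) F.

Lemma list_posE F p cs : reads 0 (enc_seq enc_cell F) ->
  reads p (enc_seq enc_cell cs) -> list_pos w p = offset F cs.
Proof.
move=> rF rc; rewrite /list_pos /offset.
under eq_count => i.
  rewrite (cell_bitE rF); under eq_all do rewrite (cell_bitE rc).
  rewrite (all_upto _ (ltnW (size_cells rc))). over.
rewrite /= (count_upto _ (ltnW (size_cells rF))) -{2}(mkseq_nth (0, 0)%R F) /mkseq count_map.
apply: eq_in_count => i; rewrite mem_iota /= add0n => iF.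
rewrite -{2}(mkseq_nth (0, 0)%R cs) /mkseq all_map.
apply: eq_in_all => k; rewrite mem_iota /= add0n => kc.
exact: cell_ltE (cell_eltE rF iF) (cell_eltE rc kc).
Qed.

End Reads.

(** * The procedure expressed by the pieces of the instance *)

Section Instance.
Variable I : instance.
Local Notation w := (encode I).
Local Notation N := (size w).
Local Notation m := (size (pieces I)).

Lemma reads_frame : reads w 0 (enc_seq enc_cell (frame I)).
Proof. by rewrite /reads drop0 /encode; eexists. Qed.

Lemma reads_pieces : reads w (pieces_at w) (enc_seq (enc_seq enc_cell) (pieces I)).
Proof.
rewrite /pieces_at (cells_endE reads_frame) add0n /reads /encode drop_size_cat //.
by eexists.
Qed.

Lemma target_atE : target_at w =
  size (enc_seq enc_cell (frame I)) + size (enc_seq (enc_seq enc_cell) (pieces I)).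
Proof.
rewrite /target_at (list_end_full (@piece_next_elt w) (@piece_next_end w) reads_pieces).
by rewrite /pieces_at (cells_endE reads_frame) add0n.
Qed.

Lemma reads_target : reads w (target_at w) (enc_nat (target I)).
Proof.
rewrite target_atE -size_cat /reads /encode catA drop_size_cat //.
by eexists.
Qed.

Lemma reads_goal : reads w (goal_at w) (enc_seq enc_cell (goal I)).
Proof.
rewrite /goal_at (nat_endE reads_target) target_atE -!size_cat /reads /encode.
by rewrite catA catA drop_size_cat //; exists [::]; rewrite cats0.
Qed.

Lemma pieces_size : m < N.
Proof.
by have := reads_size reads_pieces; have := size_enc_seq (enc_seq enc_cell) (pieces I); lia.
Qed.

Lemma piece_bitE j : nth false w (piece_elt w j) = (j < m).
Proof. exact: (list_bit [::] (@piece_next_elt w) (@piece_next_end w) j reads_pieces). Qed.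

Lemma reads_piece j : j < m ->
  reads w (piece_elt w j).+1 (enc_seq enc_cell (nth [::] (pieces I) j)).
Proof.
by move=> jm; have /reads_cons[] := list_elt_min [::] (@piece_next_elt w) reads_pieces jm.
Qed.

Definition plen j := size (nth [::] (pieces I) j).
Definition ppos j := offset (frame I) (nth [::] (pieces I) j).

Lemma piece_lenE j : piece_len w j = plen j.
Proof.
rewrite /piece_len piece_bitE /plen; case: ltnP => jm; last by rewrite nth_default.
by rewrite (cells_lenE (reads_piece jm)).
Qed.

Lemma piece_posE j : j < m -> piece_pos w j = ppos j.
Proof. by move=> jm; apply: list_posE reads_frame (reads_piece jm). Qed.

Lemma sum_pieces (P Q : pred nat) : (forall j, j < m -> P j = Q j) ->
  \sum_(j <- iota 0 N) (if P j then piece_len w j else 0) =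
  \sum_(0 <= j < m | Q j) plen j.
Proof.
(* Indices from [m] to [N] name no piece and contribute length 0, whatever [P] says about them. *)
move=> PQ; rewrite -(subnKC (ltnW pieces_size)) iotaD big_cat /= addnC big1_seq ?add0n.
  rewrite /index_iota subn0 [RHS]big_mkcond; apply: eq_big_seq => j.
  by rewrite mem_iota /= add0n => jm; rewrite PQ // piece_lenE.
move=> j /andP[_]; rewrite mem_iota => /andP[mj _].
by rewrite piece_lenE /plen nth_default //; case: ifP.
Qed.

Lemma is_bigE j : is_big w j = big (size (frame I)) m plen j.
Proof.
have totalE : total_len w = all_len m plen by apply: (@sum_pieces xpredT xpredT).
by rewrite /is_big /big /frame_len (cells_lenE reads_frame) piece_lenE totalE.
Qed.

Lemma solveP : target I < m -> size (goal I) = plen (target I) ->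
  solve w <-> exists2 c, c < N &
    cut_cond (size (frame I)) m plen ppos (target I) (offset (frame I) (goal I)) c.
Proof.
move=> Tm gT.
have tE j : j < m -> is_target w j = (j == target I).
  by move=> jm; apply: is_targetE (erefl _) reads_target _; have := pieces_size; lia.
have cut c : c < N -> good_cut w c <->
    cut_cond (size (frame I)) m plen ppos (target I) (offset (frame I) (goal I)) c.
  move=> cN; rewrite /good_cut /left_len /right_len /frame_len.
  rewrite (list_posE reads_frame reads_goal) (cells_lenE reads_goal) gT.
  rewrite (cells_lenE reads_frame).
  rewrite (@sum_pieces _ (fun j => big (size (frame I)) m plen j && (j != target I) && (ppos j < c))); last first.
    by move=> j jm; rewrite is_bigE tE // piece_posE.
  rewrite (@sum_pieces _ (fun j => big (size (frame I)) m plen j && (j != target I) && (c <= ppos j))); last first.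
    by move=> j jm; rewrite is_bigE tE // piece_posE.
  have -> : all (fun j => is_target w j && nth false w (piece_elt w j) && is_big w j ==>
        (piece_pos w j == c)) (iota 0 N) =
      (big (size (frame I)) m plen (target I) ==> (ppos (target I) == c)).
    apply/allP/implyP => [h B|h j _].
      have := h (target I); rewrite mem_iota /= add0n tE // eqxx piece_bitE Tm is_bigE B.
      by rewrite piece_posE //; apply; have := pieces_size; lia.
    apply/implyP => /andP[/andP[jT]]; rewrite piece_bitE => jm; rewrite is_bigE.
    by move: jT; rewrite tE // => /eqP -> B; rewrite piece_posE // h.
  split=> [/and3P[h1 h2 /implyP h3]|[h1 h2 h3]]; first by split=> // /h3/eqP.
  by rewrite h2 h3 /=; apply/implyP => /h1 ->.
split=> [/hasP[c]|[c cN /(cut c cN) H]].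
  by rewrite mem_iota /= add0n => cN /(cut c cN); exists c.
by apply/hasP; exists c; rewrite // mem_iota.
Qed.

End Instance.

(** * Packings of a frame of width 1 *)

Lemma adj_rot90 p q : adj (rot90 p) (rot90 q) = adj p q.
Proof. by case: p q => [a b] [c d]; rewrite /adj /rot90 /=; lia. Qed.

Lemma adj_transform r a b p q : adj (transform r a b p) (transform r a b q) = adj p q.
Proof.
have shift (x y : cell) : adj (x.1 + a, x.2 + b)%R (y.1 + a, y.2 + b)%R = adj x y.
  by rewrite /adj /=; lia.
rewrite shift; elim: r => //= r IH; by rewrite adj_rot90.
Qed.

Lemma transform_inj r a b : injective (transform r a b).
Proof.
have rot_inj : injective rot90.
  by move=> [x y] [z t] [/eqP]; rewrite eqr_opp => /eqP -> ->.
have iter_inj : injective (iter r rot90).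
  by elim: r => // r IH x y /= /rot_inj /IH.
move=> x y [/addIr h1 /addIr h2]; apply: iter_inj.
by rewrite [LHS]surjective_pairing [RHS]surjective_pairing h1 h2.
Qed.

Definition connected (S : seq cell) := forall x y, x \in S -> y \in S ->
  exists p, [/\ path adj x p, last x p = y & all (fun z => z \in S) p].

Lemma placement_connected S Q : placement_of S Q -> connected S -> connected Q.
Proof.
move=> [r [a [b [_ E]]]] cS x y; rewrite !E => /mapP[x' xS ->] /mapP[y' yS ->].
have [p [pp lp ap]] := cS _ _ xS yS; exists (map (transform r a b) p); split.
- by rewrite path_map; apply: sub_path pp => u v /=; rewrite adj_transform.
- by rewrite last_map lp.
- by rewrite all_map; apply/allP => z zp /=; rewrite E map_f // (allP ap).
Qed.

(** A placement fixes [Q] only as a set, so [Q] may repeat cells; hence [undup]. *)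
Lemma placement_size S Q : placement_of S Q -> uniq S -> size (undup Q) = size S.
Proof.
move=> [r [a [b [_ E]]]] uS; rewrite -(size_map (transform r a b)).
apply/perm_size/uniq_perm; rewrite ?undup_uniq ?(map_inj_uniq (@transform_inj r a b)) //.
by move=> x; rewrite mem_undup E.
Qed.

Lemma eq_offset F cs cs' : cs =i cs' -> offset F cs = offset F cs'.
Proof. by move=> E; apply: eq_count => f; apply: eq_all_r. Qed.

(** * Straight frames, horizontal and vertical at once *)

Section Frame.
Variables (F : seq cell) (n : nat) (L : nat -> cell).
Hypothesis F_uniq : uniq F.
Hypothesis F_line : F =i [seq L k | k <- iota 0 n].
Hypothesis L_before : forall i j, cell_before (L i) (L j) = (i < j).
Hypothesis L_adj : forall i j, adj (L i) (L j) -> i = j.+1 \/ j = i.+1.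
Hypothesis L_shift : forall a b, exists u v, forall k,
  transform 0 u v (L (a + k)) = L (b + k).

Lemma L_inj : injective L.
Proof.
move=> i j e; have := L_before i j; have := L_before j i.
by rewrite e L_before ltnn; lia.
Qed.

Lemma mem_line k : (L k \in F) = (k < n).
Proof. by rewrite F_line (mem_map L_inj) mem_iota. Qed.

Lemma lineP x : x \in F -> exists2 k, k < n & x = L k.
Proof. by rewrite F_line => /mapP[k]; rewrite mem_iota => /andP[_ kn] ->; exists k. Qed.

Lemma frame_perm : perm_eq F [seq L k | k <- iota 0 n].
Proof. by apply: uniq_perm; rewrite // (map_inj_uniq L_inj) iota_uniq. Qed.

Lemma frame_size : size F = n.
Proof. by rewrite (perm_size frame_perm) size_map size_iota. Qed.

Definition segment a l := [seq L k | k <- iota a l].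

Lemma mem_segment a l k : (L k \in segment a l) = (a <= k < a + l).
Proof. by rewrite (mem_map L_inj) mem_iota. Qed.

Lemma offset_segment a l : 0 < l -> a <= n -> offset F (segment a l) = a.
Proof.
move=> l0 an; rewrite /offset (permP frame_perm) count_map.
rewrite (eq_count (a2 := fun k => (k < a) && true)).
  by rewrite (count_upto xpredT an) count_predT size_iota.
move=> k /=; rewrite andbT /segment all_map; apply/allP/idP => [h|ka j].
  by rewrite -L_before; apply: h; rewrite mem_iota; lia.
by rewrite mem_iota /= L_before; lia.
Qed.

(** Adjacent cells of the line have consecutive indices, so a path inside the frame skips none. *)
Lemma path_crosses (S : seq cell) p i j k : {subset S <= F} -> L i \in S -> path adj (L i) p ->
  last (L i) p = L k -> all (fun z => z \in S) p -> i <= j <= k -> L j \in S.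
Proof.
move=> SF; elim: p i => [|z p IH] i iS /=.
  move=> _ /L_inj <- _ ij; have -> : j = i by lia.
  by [].
move=> /andP[iz pz] lz /andP[zS pS] ijk.
have [i' _ zE] := lineP (SF _ zS); rewrite {}zE in iz pz lz zS.
case: (eqVneq i j) => [<- //|ij]; apply: (IH i') => //.
by have := L_adj iz; lia.
Qed.

Lemma connected_segment (S : seq cell) : S != [::] -> connected S -> {subset S <= F} ->
  exists2 a, a + size (undup S) <= n & S =i segment a (size (undup S)).
Proof.
move=> S0 cS SF; pose P k := (k < n) && (L k \in S).
have exP : exists k, P k.
  case: S S0 SF @P {cS} => // x S _ SF; have xS : x \in x :: S by rewrite mem_head.
  have [k kn xE] := lineP (SF _ xS); exists k; by rewrite kn -xE xS.
have ubP k : P k -> k <= n by case/andP => /ltnW.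
case: (ex_minnP exP) => a /andP[an aS] mina.
case: (ex_maxnP exP ubP) => b /andP[bn bS] maxb.
have ab : a <= b by apply: mina; rewrite /P bn.
have SE : S =i segment a (b.+1 - a).
  move=> x; apply/idP/idP => [xS|/mapP[k]].
    have [k kn xE] := lineP (SF _ xS); rewrite {}xE in xS *.
    have Pk : P k by rewrite /P kn.
    by rewrite mem_segment; have := mina _ Pk; have := maxb _ Pk; lia.
  rewrite mem_iota => kI ->; have [p [pp lp ap]] := cS _ _ aS bS.
  by apply: (path_crosses SF aS pp lp ap); lia.
have -> : size (undup S) = b.+1 - a.
  rewrite -(size_iota a (b.+1 - a)) -(size_map L); apply/perm_size/uniq_perm.
  - exact: undup_uniq.
  - by rewrite (map_inj_uniq L_inj) iota_uniq.
  - by move=> x; rewrite mem_undup SE.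
by exists a; [lia | exact: SE].
Qed.

Lemma segment_placement (S Q : seq cell) a b l : S =i segment a l -> Q =i segment b l ->
  placement_of S Q.
Proof.
move=> SE QE; have [u [v sh]] := L_shift a b; exists 0, u, v; split=> // x.
rewrite QE; apply/mapP/mapP => [[k kI ->]|[y yS ->]].
  rewrite mem_iota in kI; exists (L (a + (k - b))); last by rewrite sh; congr L; lia.
  by rewrite SE mem_segment; lia.
move: yS; rewrite SE => /mapP[k kI ->]; rewrite mem_iota in kI.
exists (b + (k - a)); first by rewrite mem_iota; lia.
by rewrite -sh; congr (transform _ _ _ (L _)); lia.
Qed.

(** Whatever the rotation, a placed piece is connected and therefore a segment. From here on a
    packing is described by the offsets of its pieces. *)
Lemma placement_segment (S Q : seq cell) : polyomino S -> placement_of S Q -> {subset Q <= F} ->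
  offset F Q + size S <= n /\ Q =i segment (offset F Q) (size S).
Proof.
move=> [S0 [uS cS]] plQ QF; have szQ := placement_size plQ uS.
have Q0 : Q != [::].
  case: Q szQ {plQ QF} => // /esym/size0nil E; by rewrite E in S0.
have [a] := connected_segment Q0 (placement_connected plQ cS) QF.
rewrite szQ => an QE; have S_gt0 : 0 < size S by case: (S) S0.
have -> : offset F Q = a.
  by rewrite (eq_offset F QE) offset_segment //; lia.
by [].
Qed.

Variable shapes : seq (seq cell).
Local Notation m := (size shapes).
Local Notation l := (fun j => size (nth [::] shapes j)).
Hypothesis shapes_poly : forall i, i < m -> polyomino (nth [::] shapes i).
Hypothesis shapes_feasible : feasible F shapes shapes.
Local Notation position c := (fun j => offset F (nth [::] c j)).

Lemma shape_gt0 i : i < m -> 0 < l i.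
Proof. by move=> /shapes_poly [] /=; case: nth. Qed.

Lemma feasible_segment c i : feasible F shapes c -> i < m ->
  position c i + l i <= n /\ nth [::] c i =i segment (position c i) (l i).
Proof. by move=> [_ pl _] im; have [] := pl i im; apply: placement_segment (shapes_poly im). Qed.

Lemma feasible_valid c : feasible F shapes c -> valid n m l (position c).
Proof.
move=> fc; have [sz pl dis] := fc; split=> [i im|i j im jm ij].
  by have [] := feasible_segment fc im.
have [ib iE] := feasible_segment fc im; have [jb jE] := feasible_segment fc jm.
have i0 := shape_gt0 im; have j0 := shape_gt0 jm.
(* If the two segments overlapped, the cell at the larger of their offsets would lie in both. *)
rewrite -sz in im jm; have := dis i j im jm ij (L (maxn (position c i) (position c j))).
by rewrite iE jE !mem_segment; move: i0 j0; set x := offset _ _; set y := offset _ _; lia.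
Qed.

Lemma valid_feasible a c : size c = m -> valid n m l a ->
  (forall i, i < m -> nth [::] c i =i segment (a i) (l i)) -> feasible F shapes c.
Proof.
move=> sz [v1 v2] cE; split=> // [i im|i j].
  (* The shapes are themselves the initial packing, so each is a segment of the frame and a
     translation carries it to its new place. *)
  have [_ sE] := feasible_segment shapes_feasible im.
  split; first exact: segment_placement sE (cE i im).
  move=> x; rewrite cE // => /mapP[k]; rewrite mem_iota => kI ->.
  by rewrite mem_line; have := v1 i im; lia.
rewrite sz => im jm ij x; rewrite !cE // => /mapP[k]; rewrite mem_iota => kI ->.
by rewrite mem_segment; case: (v2 i j im jm ij); lia.
Qed.

Lemma reach_linked c c' : reach F shapes c c' -> feasible F shapes c ->
  feasible F shapes c' /\ linked n m l (position c) (position c').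
Proof.
elim=> {c c'} [c fc|c c' c'' _ IH [i [ic sz same _ fc'']] fc].
  by split=> //; apply: linked_refl.
have [fc' lk] := IH fc; split=> //; apply: linked_step lk _; exists i; split.
- by have [<-] := fc'.
- by move=> j _ ji; rewrite same.
- exact: feasible_valid.
Qed.

Lemma linked_reach a b : linked n m l a b -> forall c, feasible F shapes c ->
  (forall i, i < m -> position c i = a i) ->
  exists c', [/\ reach F shapes c c', feasible F shapes c' &
    forall i, i < m -> position c' i = b i].
Proof.
elim=> {a b} [a b e|a b d _ IH [i [im same vd]]] c fc ca.
  exists c; split=> //; first exact: reach_refl.
  by move=> i im; rewrite ca // e.
have [c' [rc fc' cb]] := IH c fc ca; have [sz _ _] := fc'.
pose c'' := set_nth [::] c' i (segment (d i) (l i)).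
have nthE j : nth [::] c'' j = if j == i then segment (d i) (l i) else nth [::] c' j.
  by rewrite nth_set_nth.
have sz' : size c'' = m by rewrite size_set_nth sz; apply/maxn_idPr.
have cE j : j < m -> nth [::] c'' j =i segment (d j) (l j).
  move=> jm; rewrite nthE; case: eqP => [-> //|/eqP ji]; rewrite same // -cb //.
  by have [] := feasible_segment fc' jm.
have fc'' : feasible F shapes c'' by apply: valid_feasible sz' vd cE.
exists c''; split=> //; last first.
  move=> j jm; rewrite (eq_offset F (cE j jm)) offset_segment ?shape_gt0 //.
  by case: vd => v1 _; have := v1 j jm; lia.
apply: reach_step rc _; exists i; split; rewrite ?sz //.
  by move=> j ji; rewrite nthE (negbTE ji).
have [_ sE] := feasible_segment fc' im.
exact: segment_placement sE (cE i im).
Qed.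

Lemma reachable_goal T goal : T < m -> uniq goal ->
  placement_of (nth [::] shapes T) goal -> {subset goal <= F} ->
  ((exists c, reach F shapes shapes c /\ nth [::] c T =i goal) ->
    exists2 c, c <= n & cut_cond n m l (position shapes) T (offset F goal) c) /\
  (forall c, cut_cond n m l (position shapes) T (offset F goal) c ->
    exists c, reach F shapes shapes c /\ nth [::] c T =i goal).
Proof.
move=> Tm ug pg gF; have va := feasible_valid shapes_feasible.
have [gb gE] := placement_segment (shapes_poly Tm) pg gF.
split=> [[c [rc cT]]|c /(cut_linked shape_gt0 va Tm) [b lb bT]].
  have [_ lk] := reach_linked rc shapes_feasible.
  by have := linked_cut shape_gt0 va lk Tm; rewrite /= (eq_offset F cT).
have [//|c' [rc fc' cb]] := linked_reach lb shapes_feasible.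
exists c'; split=> // x; have [_ ->] := feasible_segment fc' Tm.
by rewrite cb // bT gE.
Qed.

End Frame.

Lemma width1_line F : width1_rect F -> exists (n : nat) (L : nat -> cell),
  [/\ F =i [seq L k | k <- iota 0 n],
      forall i j, cell_before (L i) (L j) = (i < j),
      forall i j, adj (L i) (L j) -> i = j.+1 \/ j = i.+1 &
      forall a b, exists u v, forall k, transform 0 u v (L (a + k)) = L (b + k)].
Proof.
move=> [x0 [y0 [n [_ [FE|FE]]]]].
  exists n, (fun k => (x0 + k%:Z, y0)%R); split=> //.
  - by move=> i j; rewrite /cell_before /=; lia.
  - by move=> i j; rewrite /adj /=; lia.
  - move=> a b; exists (b%:Z - a%:Z)%R, 0%R => k; rewrite /transform /=.
    by congr pair; lia.
exists n, (fun k => (x0, y0 + k%:Z)%R); split=> //.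
- by move=> i j; rewrite /cell_before /=; lia.
- by move=> i j; rewrite /adj /=; lia.
- move=> a b; exists 0%R, (b%:Z - a%:Z)%R => k; rewrite /transform /=.
  by congr pair; lia.
Qed.

Lemma solvable_solve I : valid_width1 I -> solvable I <-> solve (encode I).
Proof.
move=> [wF uF poly feas [Tm ug pg gF]].
have [n [L [FE Lb La Ls]]] := width1_line wF.
have sF := frame_size uF FE Lb.
have szg : size (goal I) = plen I (target I).
  have [_ [uT _]] := poly _ Tm.
  by rewrite -(undup_id ug) (placement_size pg uT).
have [to_cut of_cut] := reachable_goal uF FE Lb La Ls poly feas Tm ug pg gF.
have sp := solveP Tm szg; rewrite sF in sp.
split=> [/to_cut [c cn H]|/sp [c _ /of_cut //]].
(* The procedure tries the cuts below [N]. This one is at most [n], and [n < N] because the word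
   lists the whole frame. *)
by apply/sp; exists c => //; have := size_cells (reads_frame I); rewrite sF; lia.
Qed.

Theorem theorem11 :
  exists (M : TM) (c d : nat),
    forall I : instance, valid_width1 I ->
      let w := encode I in
      let cfg := tm_run M (c * size w ^ d + c) w in
      tm_halted cfg /\ (tm_accepts cfg <-> solvable I).
Proof.
have [e E] := comp_solve; have [M [c [d run]]] := exp_polytime e.
exists M, c, d => I vI w cfg; have [halted accepts] := run w; split=> //.
rewrite /cfg accepts; have /= -> := E w tt.
by rewrite lt0b; apply: iff_sym; apply: solvable_solve.
Qed.
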